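(* Let $(M,\varphi,\xi,\eta,g)$ be a Kenmotsu manifold of dimension $3$. If $g$ is a $*$-Ricci soliton, i.e. there are a vector field $V$ on $M$ and a constant $\lambda\in\mathbb{R}$ with $\pounds_V g+2S^*+2\lambda g=0$, then $(M,g)$ is of constant sectional curvature $-1$.
   Context: All manifolds, tensors and functions are smooth; $\mathfrak{X}(M)$ denotes the vector fields on $M$; $\pounds$ is the Lie derivative; $\nabla$ is the Levi-Civita connection of $g$. An almost contact metric manifold $(M,\varphi,\xi,\eta,g)$ of dimension $2n+1$ ($n\ge 1$) is a smooth manifold with a $(1,1)$-tensor field $\varphi$, a vector field $\xi$ (the characteristic vector field), a 1-form $\eta$ and a Riemannian metric $g$ such that $\varphi^2=-I+\eta\otimes\xi$, $\eta(\xi)=1$ and $g(\varphi X,\varphi Y)=g(X,Y)-\eta(X)\eta(Y)$ for all $X,Y\in\mathfrak{X}(M)$. It is called Kenmotsu if $(\nabla_X\varphi)Y=g(\varphi X,Y)\xi-\eta(Y)\varphi X$ for all $X,Y\in\mathfrak{X}(M)$. The curvature convention is $R(X,Y)=[\nabla_X,\nabla_Y]-\nabla_{[X,Y]}$. The $*$-Ricci tensor is $S^*(X,Y)=\frac12\,\mathrm{trace}\big(Z\mapsto R(X,\varphi Y)\varphi Z\big)$. *)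

(* Defs.v *)
From HB Require Import structures.
From mathcomp Require Import all_boot all_order all_algebra.
From mathcomp Require Import ring.
From mathcomp Require Import all_classical all_reals all_analysis.

Set Implicit Arguments.
Unset Strict Implicit.
Unset Printing Implicit Defensive.

Import Order.TTheory GRing.Theory Num.Theory.
Import numFieldNormedType.Exports.

Local Open Scope classical_set_scope.
Local Open Scope ring_scope.

Section SmoothOn.
Context {R : realType} {n : nat}.
Implicit Types (U : set 'rV[R]_n) (f g : 'rV[R]_n -> R).

Definition partial (i : 'I_n) f : 'rV[R]_n -> R :=
  fun x => 'D_(delta_mx ord0 i) f x.

Fixpoint diff_upto (k : nat) U f : Prop :=
  if k is k'.+1 then
    (forall x, U x -> differentiable f x) /\
    (forall i, diff_upto k' U (partial i f))
  else True.

(* C^oo on U (meant for U open): the iterated partial derivatives of every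
   order exist and are differentiable, hence continuous, on U. *)
Definition smooth_on U f : Prop := forall k, diff_upto k U f.

Lemma near_eq_differentiable f g x :
  (\near x, f x = g x) -> differentiable f x -> differentiable g x.
Proof.
move=> fg /diff_locallyP[cdf fE].
have gE : g \o shift x = cst (g x) + 'd f x +o_ 0 id.
  apply/eqaddoP => _/posnumP[e].
  have /eqaddoP /(_ e%:num (gt0 _)) := fE.
  apply: filterS2; last first.
    by move: fg; rewrite (near_shift 0 x) /= => H; exact: H.
  move=> y /=; rewrite subr0 => fgy.
  by rewrite !fctE /= fgy (nbhs_singleton fg).
apply/diff_locallyP.
by have -> : 'd g x = 'd f x :> (_ -> _) by exact: diff_unique.
Qed.

Lemma eq_diff_upto k U f g : open U -> (forall x, U x -> f x = g x) ->
  diff_upto k U f -> diff_upto k U g.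
Proof.
move=> oU; elim: k f g => // k IHk f g fg [df pf].
have nfg x : U x -> \near x, f x = g x.
  by move=> Ux; near=> y; apply: fg; near: y; exact: open_nbhs_nbhs.
split=> [x Ux|i]; first exact: near_eq_differentiable (nfg _ Ux) (df _ Ux).
by apply: IHk (pf i) => x Ux; exact: near_eq_derive (nfg _ Ux).
Unshelve. all: by end_near. Qed.

Lemma diff_uptoS k U f : diff_upto k.+1 U f -> diff_upto k U f.
Proof. by elim: k f => // k IHk f [df pf]; split=> // i; exact: IHk. Qed.

Lemma diff_upto_cst k U (c : R) : open U -> diff_upto k U (cst c).
Proof.
move=> oU; elim: k c => // k IHk c; split=> [x _|i].
  exact: differentiable_cst.
by apply: eq_diff_upto (IHk 0) => // x _; rewrite /partial derive_cst.
Qed.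

Lemma diff_uptoD k U f g : open U ->
  diff_upto k U f -> diff_upto k U g -> diff_upto k U (f + g).
Proof.
move=> oU; elim: k f g => // k IHk f g [df pf] [dg pg]; split=> [x Ux|i].
  by apply: differentiableD; [exact: df | exact: dg].
apply: eq_diff_upto (IHk _ _ (pf i) (pg i)) => // x Ux.
by rewrite /partial deriveD //; apply: diff_derivable; [exact: df | exact: dg].
Qed.

Lemma diff_uptoM k U f g : open U ->
  diff_upto k U f -> diff_upto k U g -> diff_upto k U (f * g).
Proof.
move=> oU; elim: k f g => // k IHk f g Hf Hg.
have [[df pf] [dg pg]] := (Hf, Hg); split=> [x Ux|i].
  by apply: differentiableM; [exact: df | exact: dg].
have Hp := diff_uptoD oU (IHk _ _ (diff_uptoS Hf) (pg i))
                         (IHk _ _ (diff_uptoS Hg) (pf i)).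
apply: eq_diff_upto Hp => // x Ux.
by rewrite /partial deriveM //; apply: diff_derivable; [exact: df | exact: dg].
Qed.

End SmoothOn.

Section Manifold.
Context (R : realType) (n : nat).

(* A homeomorphism between an open subset of M and an open subset of R^n. *)
Record chart (M : topologicalType) := Chart {
  chart_dom : set M;
  chart_img : set 'rV[R]_n;
  chart_map : M -> 'rV[R]_n;
  chart_inv : 'rV[R]_n -> M;
  chart_dom_open : open chart_dom;
  chart_img_open : open chart_img;
  chart_map_img : forall p, chart_dom p -> chart_img (chart_map p);
  chart_inv_dom : forall x, chart_img x -> chart_dom (chart_inv x);
  chart_mapK : forall p, chart_dom p -> chart_inv (chart_map p) = p;
  chart_invK : forall x, chart_img x -> chart_map (chart_inv x) = x;
  chart_map_cont : {within chart_dom, continuous chart_map};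
  chart_inv_cont : {within chart_img, continuous chart_inv} }.

(* Smooth compatibility of c and d in one direction: d o c^-1 is smooth on the
   open set c(dom c `&` dom d). *)
Definition smooth_transition (M : topologicalType) (c d : chart M) : Prop :=
  forall i : 'I_n,
    smooth_on (chart_img c `&` chart_inv c @^-1` chart_dom d)
      (fun x => chart_map d (chart_inv c x) ord0 i).

Record manifold := Manifold {
  manifold_space :> topologicalType;
  atlas : set (chart manifold_space);
  manifold_hausdorff : hausdorff_space manifold_space;
  manifold_second_countable : @second_countable manifold_space;
  atlas_cover : forall p : manifold_space, exists2 c, atlas c & chart_dom c p;
  atlas_compat : forall c d, atlas c -> atlas d -> smooth_transition c d }.

End Manifold.

Section SmoothFunctions.
Context {R : realType} {n : nat} (M : manifold R n).

Definition smooth : {pred M -> R} := fun f =>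
  `[< forall c, atlas c -> smooth_on (chart_img c) (f \o chart_inv c) >].

Lemma smooth_cst (c : R) : cst c \in smooth.
Proof. by apply/asboolP => d _ k; exact/diff_upto_cst/chart_img_open. Qed.

Fact smooth_subring : subring_closed smooth.
Proof.
have smoothM : {in smooth &, forall f g, f * g \in smooth}.
  move=> f g /asboolP sf /asboolP sg; apply/asboolP => c Ac k.
  have /= := diff_uptoM (@chart_img_open _ _ _ c) (sf c Ac k) (sg c Ac k).
  by apply: eq_diff_upto (@chart_img_open _ _ _ c) _ => x _; rewrite /= !fctE.
split=> //; first exact: smooth_cst.
move=> f g sf /(smoothM _ _ (smooth_cst (-1))).
move: sf => /asboolP sf /asboolP sg; apply/asboolP => c Ac k.
apply: eq_diff_upto (@chart_img_open _ _ _ c) _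
  (diff_uptoD (@chart_img_open _ _ _ c) (sf c Ac k) (sg c Ac k)) => x _.
by rewrite /= !fctE /= mulN1r.
Qed.
HB.instance Definition _ :=
  GRing.isSubringClosed.Build (M -> R) smooth smooth_subring.

(* The ring C^oo(M). *)
Record smooth_fun := SmoothFun {
  smooth_fun_val :> M -> R;
  smooth_funP : smooth_fun_val \in smooth }.
HB.instance Definition _ := [isSub for smooth_fun_val].
HB.instance Definition _ := [Choice of smooth_fun by <:].
HB.instance Definition _ := GRing.SubChoice_isSubComPzRing.Build _ _ smooth_fun (subringClosedP _).

Definition const_fun (c : R) : smooth_fun := SmoothFun (smooth_cst c).

End SmoothFunctions.

Section VectorFields.
Context {R : realType} {n : nat} (M : manifold R n).
Local Notation C := (smooth_fun M).

(* Vector fields are the R-linear derivations of C^oo(M); the scalar c of R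
   acts on C^oo(M) as multiplication by const_fun M c. *)
Definition derivation : {pred C -> C^o} := fun D => `[<
  [/\ forall (c : R) (f g : C), D (const_fun M c * f + g)
                                = const_fun M c * D f + D g
    & forall f g : C, D (f * g) = D f * g + f * D g] >].

Fact derivation_submod : submod_closed derivation.
Proof.
split.
  apply/asboolP; split=> [c f g|f g].
    by rewrite -![(0 : C -> C^o) _]/(0 : C) mulr0 addr0.
  by rewrite -![(0 : C -> C^o) _]/(0 : C) mul0r mulr0 addr0.
move=> h D E /asboolP[linD leibD] /asboolP[linE leibE]; apply/asboolP.
have hDE f : (h *: D + E) f = h * D f + E f :> C by [].
split=> [c f g|f g]; rewrite !hDE.
  rewrite linD linE !mulrDr.
  by rewrite (mulrCA h) addrACA.
rewrite leibD leibE !mulrDr !mulrDl !mulrA.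
by rewrite (mulrC f h) addrACA.
Qed.
HB.instance Definition _ :=
  GRing.isSubmodClosed.Build C (C -> C^o) derivation derivation_submod.

(* The C^oo(M)-module of vector fields; X f is the function p |-> X_p f. *)
Record vfield := VField {
  vfield_fun :> C -> C^o;
  vfieldP : vfield_fun \in derivation }.
HB.instance Definition _ := [isSub for vfield_fun].
HB.instance Definition _ := [Choice of vfield by <:].
HB.instance Definition _ := [SubChoice_isSubLmodule of vfield by <:].

Fact bracket_subproof (X Y : vfield) :
  (fun f => X (Y f) - Y (X f) : C^o) \in derivation.
Proof.
have [/asboolP[linX leibX] /asboolP[linY leibY]] := (vfieldP X, vfieldP Y).
have c1 : const_fun M 1 = 1 by exact: val_inj.
have addX (Z : vfield) f g : Z (f + g) = Z f + Z g :> C.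
  have /asboolP[linZ _] := vfieldP Z.
  by rewrite -{1}[f]mul1r -c1 linZ c1 mul1r.
apply/asboolP; split=> [c f g|f g].
  by rewrite linY linX linX linY mulrBr opprD addrACA.
by rewrite leibY leibX !addX !leibX !leibY; ring.
Qed.
Definition bracket (X Y : vfield) : vfield := VField (bracket_subproof X Y).

End VectorFields.

Section Geometry.
Context {R : realType} {n : nat} {M : manifold R n}.
Local Notation C := (smooth_fun M).
Local Notation XM := (vfield M).
Implicit Types (p : M) (X Y Z V xi : XM) (A phi : XM -> XM) (eta : XM -> C)
  (g : XM -> XM -> C) (nabla : XM -> XM -> XM).

(* The tangent vector X_p, as a point derivation at p. *)
Definition at_point p X : C -> R^o := fun f => X f p.

Definition basis_at p (E : 'I_n -> XM) : Prop :=
  (forall a : 'I_n -> R,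
     \sum_i a i *: at_point p (E i) = 0 -> forall i, a i = 0) /\
  (forall X, exists a : 'I_n -> R,
     at_point p X = \sum_i a i *: at_point p (E i)).

(* For A linear over C^oo(M), the endomorphism X_p |-> (A X)_p of T_pM has
   matrix a in the basis (E i)_p, and its trace does not depend on E. *)
Definition trace A p : R :=
  xget 0 [set t | exists (E : 'I_n -> XM) (a : 'M[R]_n),
    [/\ basis_at p E,
        forall j, at_point p (A (E j)) = \sum_i a i j *: at_point p (E i)
      & t = \tr a]].

(* Tensor fields are maps that are linear over C^oo(M) in each argument. *)
Record riemannian_metric g : Prop := {
  metric_linear : forall Y, scalar (fun X => g X Y);
  metric_sym : forall X Y, g X Y = g Y X;
  metric_pos : forall X p, at_point p X <> 0 -> 0 < g X X p }.

Record levi_civita g nabla : Prop := {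
  connection_linear : forall Z, linear (fun X => nabla X Z);
  connection_add : forall X Y Z, nabla X (Y + Z) = nabla X Y + nabla X Z;
  connection_leibniz : forall X (f : C) Y,
    nabla X (f *: Y) = (X f : C) *: Y + f *: nabla X Y;
  connection_torsion_free : forall X Y, nabla X Y - nabla Y X = bracket X Y;
  connection_metric : forall X Y Z,
    X (g Y Z) = g (nabla X Y) Z + g Y (nabla X Z) }.

Record almost_contact_metric phi xi eta g : Prop := {
  acm_phi_linear : linear phi;
  acm_eta_linear : scalar eta;
  acm_metric : riemannian_metric g;
  acm_phi_phi : forall X, phi (phi X) = - X + eta X *: xi;
  acm_eta_xi : eta xi = 1;
  acm_compat : forall X Y, g (phi X) (phi Y) = g X Y - eta X * eta Y }.

Record kenmotsu phi xi eta g nabla : Prop := {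
  kenmotsu_acm : almost_contact_metric phi xi eta g;
  kenmotsu_levi_civita : levi_civita g nabla;
  kenmotsu_eq : forall X Y, nabla X (phi Y) - phi (nabla X Y) =
                            g (phi X) Y *: xi - eta Y *: phi X }.

Definition curvature nabla X Y Z : XM :=
  nabla X (nabla Y Z) - nabla Y (nabla X Z) - nabla (bracket X Y) Z.

Definition star_ricci nabla phi X Y p : R :=
  2^-1 * trace (fun Z => curvature nabla X (phi Y) (phi Z)) p.

Definition lie_metric V g X Y : C :=
  V (g X Y) - g (bracket V X) Y - g X (bracket V Y).

Definition star_ricci_soliton phi g nabla V (lambda : R) : Prop :=
  forall X Y p, lie_metric V g X Y p + 2 * star_ricci nabla phi X Y p
                + 2 * lambda * g X Y p = 0.

Definition sectional_curvature g nabla X Y p : R :=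
  g (curvature nabla X Y Y) X p / (g X X p * g Y Y p - g X Y p ^+ 2).

Definition constant_sectional_curvature g nabla (k : R) : Prop :=
  forall p X Y,
    (forall a b : R, a *: at_point p X + b *: at_point p Y = 0 ->
       a = 0 /\ b = 0) ->
    sectional_curvature g nabla X Y p = k.

End Geometry.

(* Main.v *)
(** Let [K] be the sectional curvature of the planes orthogonal to [xi] and
    [mu = K + 1]. In dimension 3 one has
    [R(X,Y)Z = g(X,Z)Y - g(Y,Z)X + mu g(X,phi Y) phi Z], hence
    [S^* = (mu - 1)(g - eta (x) eta)], the claim is [mu = 0], and the second
    Bianchi identity gives [xi mu = -2 mu]. For a soliton [(V, lambda)] the
    soliton equation determines [nabla V] up to a rotation [om] of the
    horizontal planes. With [f = eta V], the Ricci identities of [V] and of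
    [grad f] give successively [lambda = 0],
    [Hess f = - 2 mu g] on horizontal vectors, [2 d mu = mu (df - 4 eta)], and a
    formula for [d om]; the integrability condition [d (d om) = 0] reads
    [mu (2 V f - |df|^2 + 24 - 8 f) = 0]. As [d mu] is a multiple of [mu], an
    equation [mu F = 0] may be differentiated to [mu dF = 0]; differentiating the
    previous one along [grad f] repeatedly forces [mu |df|^2 = 0], then
    [mu (f - 3) = 0], [mu df = 0], [mu Hess f = 0], and so [mu = 0].

    The equations are derived in the module of vector fields, without local
    frames. That this module has rank 3 at every point is where bump functions and
    Hadamard's lemma are needed, since vector fields are global derivations. *)
Require Import Defs.
From HB Require Import structures.
From mathcomp Require Import all_boot all_order all_algebra.
From mathcomp Require Import ring lra.
From mathcomp Require Import all_classical all_reals all_analysis.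

Set Implicit Arguments.
Unset Strict Implicit.
Unset Printing Implicit Defensive.

Import Order.TTheory GRing.Theory Num.Theory.
Import numFieldNormedType.Exports.

Local Open Scope classical_set_scope.
Local Open Scope ring_scope.

(** * Smooth functions on open subsets of R^n *)

Section SmoothOnTheory.
Context {R : realType} {n : nat}.
Implicit Types (U V : set 'rV[R]_n) (f g : 'rV[R]_n -> R).

Lemma deriveE_partial f x v : differentiable f x ->
  'D_v f x = \sum_i v ord0 i * partial i f x.
Proof.
move=> df; rewrite deriveE // {1}(row_sum_delta v) linear_sum /=.
by apply: eq_bigr => i _; rewrite linearZ /= /partial deriveE.
Qed.

Lemma partial_near_eq i f g x : (\near x, f x = g x) ->
  partial i f x = partial i g x.
Proof. exact: near_eq_derive. Qed.

Lemma diff_upto_sub k U V f : V `<=` U -> diff_upto k U f -> diff_upto k V f.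
Proof.
move=> VU; elim: k f => // k IHk f [df pf]; split=> [x /VU Ux|i].
  exact: df.
exact: IHk (pf i).
Qed.

(** The sets V need not be open: [diff_upto] constrains globally defined functions only at the
    points of the set, so restriction and patching are both pointwise. *)
Lemma diff_upto_local k U f :
  (forall x, U x -> exists2 V, V x & diff_upto k V f) -> diff_upto k U f.
Proof.
elim: k f => // k IHk f H; split=> [x Ux|i].
  by have [V Vx [dV _]] := H x Ux; exact: dV.
by apply: IHk => x Ux; have [V Vx [_ pV]] := H x Ux; exists V => //; exact: pV.
Qed.

Lemma diff_upto0 k U : open U -> diff_upto k U (0 : 'rV[R]_n -> R).
Proof. exact: diff_upto_cst. Qed.

Lemma diff_upto_sum k U (I : Type) (r : seq I) (F : I -> 'rV[R]_n -> R) :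
  open U -> (forall i, diff_upto k U (F i)) ->
  diff_upto k U (fun x => \sum_(i <- r) F i x).
Proof.
move=> oU HF; elim: r => [|i r IHr].
  by apply: eq_diff_upto (diff_upto0 k oU) => // x _; rewrite big_nil.
apply: eq_diff_upto (diff_uptoD oU (HF i) IHr) => // x _.
by rewrite big_cons !fctE.
Qed.

Lemma partial_coord (i j : 'I_n) (x : 'rV[R]_n) :
  partial i (fun y => y ord0 j) x = (i == j)%:R.
Proof.
rewrite /partial deriveE; last exact: differentiable_coord.
have lin : linear (fun y : 'rV[R]_n => y ord0 j : R^o).
  by move=> a u v; rewrite !mxE.
pose L : {linear 'rV[R]_n -> R^o} := HB.pack (fun y : 'rV[R]_n => y ord0 j : R^o)
  (GRing.isLinear.Build _ _ _ _ _ lin).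
have -> : 'd (fun y : 'rV[R]_n => y ord0 j) x = 'd L x by [].
rewrite diff_lin; last exact: coord_continuous.
by rewrite /= mxE eqxx eq_sym.
Qed.

Lemma diff_upto_coord k U j : open U -> diff_upto k U (fun y => y ord0 j).
Proof.
move=> oU; case: k => // k; split=> [x _|i]; first exact: differentiable_coord.
apply: eq_diff_upto (diff_upto_cst k (i == j)%:R oU) => // x _.
by rewrite partial_coord.
Qed.

(** The i-th partial derivative of 1/f is minus that of f times (1/f)^2, and the induction
    hypothesis applies to 1/f itself. *)
Lemma diff_uptoV k U f : open U -> (forall x, U x -> f x != 0) ->
  diff_upto k U f -> diff_upto k U (fun x => (f x)^-1).
Proof.
move=> oU f0; elim: k => // k IHk Hf; have [df pf] := Hf.
have Hi := IHk (diff_uptoS Hf); split=> [x Ux|i].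
  exact: differentiableV (df x Ux) (f0 x Ux).
apply: eq_diff_upto (diff_uptoM oU (diff_upto_cst k (-1) oU)
  (diff_uptoM oU (pf i) (diff_uptoM oU Hi Hi))) => // x Ux.
rewrite /partial deriveV ?f0 //; last exact/diff_derivable/df.
by rewrite !fctE /= -exprVn expr2 mulN1r -[_ *: _]/(_ * _) mulNr mulrC.
Qed.

End SmoothOnTheory.

(** By the chain rule a partial derivative of [f \o h] is a sum of products of partial derivatives
    of the components of h with functions [partial j f \o h], to which the induction hypothesis
    applies. *)
Lemma diff_upto_comp (R : realType) m n k (U : set 'rV[R]_m) (V : set 'rV[R]_n)
    (h : 'rV[R]_m -> 'rV[R]_n) (f : 'rV[R]_n -> R) :
  open U -> (forall x, U x -> V (h x)) ->
  (forall j, diff_upto k U (fun x => h x ord0 j)) ->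
  diff_upto k V f -> diff_upto k U (f \o h).
Proof.
move=> oU UV; elim: k f => // k IHk f Hh [df pf].
have dh x : U x -> differentiable h x.
  move=> Ux; have -> : h = \sum_j (fun x => h x ord0 j *: delta_mx ord0 j).
    by apply/funext => y; rewrite fct_sumE [LHS]row_sum_delta.
  apply: differentiable_sum => j; apply: differentiableZl.
  by have [d _] := Hh j; exact: d.
have dfh x : U x -> differentiable (f \o h) x.
  by move=> Ux; apply: differentiable_comp; [exact: dh|exact/df/UV].
split=> // i.
have Hs j : diff_upto k U (partial j f \o h).
  by apply: IHk (pf j) => l; exact: diff_uptoS.
have := diff_upto_sum (index_enum 'I_n) oU (fun j =>
  diff_uptoM oU ((Hh j).2 i) (Hs j)).
apply: eq_diff_upto => // x Ux.
rewrite /partial (deriveE _ (dfh x Ux)).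
have -> : 'd (f \o h) x (delta_mx ord0 i) = 'd f (h x) ('d h x (delta_mx ord0 i)).
  by rewrite (diff_comp (dh x Ux) (df _ (UV _ Ux))).
rewrite -deriveE; last exact/df/UV.
rewrite deriveE_partial; last exact/df/UV.
apply: eq_bigr => j _; rewrite !fctE /=; congr (_ * _).
rewrite -deriveE; last exact: dh.
by rewrite derive_mx ?mxE //; exact/diff_derivable/dh.
Qed.

(** * Flat exponentials and bump functions *)

Section FlatExponential.
Context {R : realType}.

(* For t > 0 the derivative of flat_exp m is flat_exp m.+2 - m * flat_exp m.+1,
   so the class of these functions is stable under differentiation. *)
Definition flat_exp (m : nat) (t : R) : R :=
  if 0 < t then t^-1 ^+ m * expR (- t^-1) else 0.

Lemma flat_exp_ge0 m t : 0 <= flat_exp m t.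
Proof.
rewrite /flat_exp; case: ifPn => // t0.
by rewrite mulr_ge0 ?exprn_ge0 ?invr_ge0 ?expR_ge0 ?ltW.
Qed.

(** One term of the exponential series at u = 1/t bounds e^u from below by u^(m+2)/(m+2)!. A bound
    quadratic in t makes the difference quotient at 0 tend to 0. *)
Lemma flat_exp_le m t : `|flat_exp m t| <= (m.+2)`!%:R * `|t| ^+ 2.
Proof.
rewrite ger0_norm ?flat_exp_ge0 // /flat_exp; case: ifPn => [t0|_]; last first.
  by rewrite mulr_ge0 // exprn_ge0.
rewrite gtr0_norm //; set u := t^-1.
have u0 : 0 < u by rewrite invr_gt0.
have F0 : 0 < (m.+2)`!%:R :> R by rewrite ltr0n fact_gt0.
have := expR_ge1Dxn m.+1 (ltW u0) => H.
have {}H : u ^+ m.+2 / (m.+2)`!%:R <= expR u by lra.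
rewrite expRN ler_pdivrMr ?expR_gt0 //.
have -> : u ^+ m = t ^+ 2 * u ^+ m.+2.
  by rewrite -(addn2 m) exprD mulrCA /u -exprMn divff ?gt_eqF // expr1n mulr1.
rewrite [leRHS]mulrAC [leRHS]mulrC ler_pM2l ?exprn_gt0 //.
by rewrite [leRHS]mulrC -ler_pdivrMr.
Qed.

Lemma is_derive_flat_exp m (t : R) :
  is_derive t 1 (flat_exp m) (flat_exp m.+2 t - m%:R * flat_exp m.+1 t).
Proof.
case: (ltgtP t 0) => [t0|t0|->].
- have E : \near t, cst 0 t = flat_exp m t.
    near=> s; rewrite /flat_exp ifF //; apply/negbTE; rewrite -leNgt ltW //.
    by near: s; exact: lt_nbhsl.
  apply: near_eq_is_derive E _; rewrite /flat_exp !ltNge ltW //=.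
  by rewrite mulr0 subr0; exact: is_derive_cst.
- have E : \near t, (fun s => s^-1 ^+ m * expR (- s^-1)) t = flat_exp m t.
    near=> s; rewrite /flat_exp ifT //; near: s; exact: lt_nbhsr.
  apply: near_eq_is_derive E _; rewrite /flat_exp t0.
  have t1 : t != 0 by rewrite gt_eqF.
  have dinv := is_deriveV t1 (is_derive_id t 1).
  have dexp : is_derive t 1 (expR \o (fun s => - s^-1)) (t^-1 ^+ 2 * expR (- t^-1)).
    apply: is_derive_eq.
    by rewrite -[_%:A]/(_ * 1) mulr1 opprK mulrC exprVn.
  have dp : is_derive t 1 ((fun s : R => s^-1) ^+ m * (expR \o (fun s => - s^-1))) 
     (t^-1 ^+ m.+2 * expR (- t^-1) - m%:R * (t^-1 ^+ m.+1 * expR (- t^-1))).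
    apply: is_derive_eq; rewrite !fctE /= -![_%:A]/(_ * 1) -![_ *: _]/(_ * _).
    rewrite -exprVn mulr1.
    (* For m = 0 the predecessor truncates, but then the factor [m%:R] vanishes. *)
    have Em : m%:R * t^-1 ^+ m.-1 * t^-1 ^+ 2 = m%:R * t^-1 ^+ m.+1 :> R.
      by case: (m) => [|k]; rewrite ?mul0r // -mulrA -exprD addn2.
    rewrite mulrN mulrN Em !(exprS _ m.+1) !(exprS _ m); ring.
  by move: dp; rewrite exprfctE.
- have f1 k : flat_exp k 0 = 0 by rewrite /flat_exp ltxx.
  rewrite !f1 mulr0 subr0.
  suff H : h^-1 *: ((flat_exp m \o shift 0) (h *: (1 : R)) - flat_exp m 0)
      @[h --> 0^'] --> (0 : R).
    apply: DeriveDef; first by apply/cvg_ex; exists 0.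
    exact: cvg_lim.
  rewrite f1; apply/cvgrPdist_le => e e0.
  near=> h; rewrite sub0r normrN subr0 /= addr0 -[h *: 1]/(h * 1) mulr1.
  have h0 : h != 0 by near: h; exact: nbhs_dnbhs_neq.
  rewrite -[_ *: _]/(_ * _) normrM normfV ler_pdivrMl ?normr_gt0 //.
  apply: le_trans (flat_exp_le _ _) _.
  rewrite expr2 mulrA mulrC ler_pM2l ?normr_gt0 //.
  rewrite -ler_pdivlMl ?ltr0n ?fact_gt0 //.
  near: h; apply: dnbhs0_le; rewrite mulr_gt0 ?invr_gt0 ?ltr0n ?fact_gt0 //.
Unshelve. all: by end_near. Qed.

End FlatExponential.

Lemma diff_upto_flat_exp (R : realType) n k m (U : set 'rV[R]_n) (q : 'rV[R]_n -> R) :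
  open U -> diff_upto k U q -> diff_upto k U (flat_exp m \o q).
Proof.
move=> oU; elim: k m => // k IHk m Hq; have [dq pq] := Hq.
have dF (t : R) : differentiable (flat_exp m) t.
  by apply/derivable1_diffP; have [] := is_derive_flat_exp m t.
have dFq x : U x -> differentiable (flat_exp m \o q) x.
  by move=> Ux; apply: differentiable_comp; [exact: dq|exact: dF].
split=> // i.
have Hq' := diff_uptoS Hq.
have := diff_uptoM oU (diff_uptoD oU (IHk m.+2 Hq')
  (diff_uptoM oU (diff_upto_cst k (- m%:R) oU) (IHk m.+1 Hq'))) (pq i).
apply: eq_diff_upto => // x Ux.
rewrite /partial (deriveE _ (dFq x Ux)).
have -> : 'd (flat_exp m \o q) x (delta_mx ord0 i)
        = 'd (flat_exp m) (q x) ('d q x (delta_mx ord0 i)).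
  by rewrite (diff_comp (dq x Ux) (dF _)).
have := is_derive_flat_exp m (q x) => -[_ /(congr1 (fun u => 'd q x (delta_mx ord0 i) * u))].
rewrite (deriveE _ (dF (q x))).
have -> (u : R) : u * ('d (flat_exp m) (q x)) 1 = 'd (flat_exp m) (q x) u.
  by rewrite -[u in RHS]mulr1 -[u * 1 in RHS]/(u *: 1) linearZ.
move=> ->; rewrite !fctE /= -deriveE; last exact: dq.
by rewrite mulNr mulrC.
Qed.

Section Bump.
Context {R : realType} {n : nat}.
Implicit Types (a x : 'rV[R]_n) (e : R).

(** The Euclidean square is taken because the norm on row vectors is the sup norm, which is not
    smooth. The support then lies in a sup-norm cube, which is compact. *)
Definition ball_bump a e x : R :=
  flat_exp 0 (e ^+ 2 - \sum_i (x ord0 i - a ord0 i) ^+ 2).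

Lemma ball_bump_center a e : 0 < e -> 0 < ball_bump a e a.
Proof.
move=> e0; rewrite /ball_bump big1 => [|i _]; last by rewrite subrr expr0n.
by rewrite subr0 /flat_exp exprn_gt0 // mul1r expR_gt0.
Qed.

Lemma ball_bump_support a e x : 0 < e -> ball_bump a e x != 0 ->
  forall i, `|x ord0 i - a ord0 i| <= e.
Proof.
move=> e0; rewrite /ball_bump /flat_exp; case: ifPn => [+ _ i|]; last by rewrite eqxx.
rewrite subr_gt0 (bigD1 i) //= => lt_e.
rewrite -ler_sqr ?nnegrE ?normr_ge0 ?ltW // real_normK ?num_real //.
by apply: le_lt_trans lt_e; rewrite lerDl sumr_ge0 // => j _; rewrite sqr_ge0.
Qed.

Lemma smooth_on_ball_bump a e U : open U -> smooth_on U (ball_bump a e).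
Proof.
move=> oU k.
have c (j : 'I_n) : diff_upto k U (fun x => x ord0 j - a ord0 j).
  exact: (diff_uptoD oU (diff_upto_coord k j oU) (diff_upto_cst k (- a ord0 j) oU)).
have s := diff_upto_sum (index_enum 'I_n) oU (fun j => diff_uptoM oU (c j) (c j)).
apply: diff_upto_flat_exp => //.
have := diff_uptoD oU (diff_upto_cst k (e ^+ 2) oU)
  (diff_uptoM oU (diff_upto_cst k (-1) oU) s).
by apply: eq_diff_upto => // x _; rewrite !fctE /= mulN1r.
Qed.

Lemma compact_cube a e : compact [set x : 'rV[R]_n | forall i, `|x ord0 i - a ord0 i| <= e].
Proof.
have := @rV_compact R n (fun i => `[a ord0 i - e, a ord0 i + e]%classic)
  (fun i => @segment_compact _ _ _).
congr compact; apply/funext => x /=; apply/propext; split=> H i; have := H i.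
  by rewrite /= in_itv /= ler_distl.
by rewrite /= in_itv /= ler_distl.
Qed.

End Bump.

Lemma ler_coord_norm (R : realType) n (v : 'rV[R]_n) i : `|v ord0 i| <= `|v|.
Proof.
rewrite [leRHS]/Num.norm /= mx_normrE.
exact: (le_bigmax _ (fun ij : 'I_1 * 'I_n => `|v ij.1 ij.2|) (ord0, i)).
Qed.

Lemma is_derive_line (R : realType) n (F : 'rV[R]_n -> R) a w (t : R) :
  differentiable F (a + t *: w) ->
  is_derive t 1 (fun t => F (a + t *: w)) ('D_w F (a + t *: w)).
Proof.
move=> /(@diff_derivable _ _ _ _ _ w) dF.
have E : (fun h => h^-1 *:
    (((fun t => F (a + t *: w)) \o shift t) (h *: (1 : R)) - F (a + t *: w)))
  = (fun h => h^-1 *: ((F \o shift (a + t *: w)) (h *: w) - F (a + t *: w))).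
  apply/funext => h /=; congr (_ *: (F _ - _)).
  by rewrite -[h *: 1]/(h * 1) mulr1 scalerDl addrCA.
by apply: DeriveDef; rewrite ?/derivable ?/derive E.
Qed.

(** * Averages along segments and Hadamard's lemma *)

Section Average.
Context {R : realType} {n : nat}.
Local Notation mu := (@lebesgue_measure R).
Implicit Types (U : set 'rV[R]_n) (F : 'rV[R]_n -> R) (x y : 'rV[R]_n).

Lemma continuous_unit_integrable (h : R -> R) :
  (forall s, 0 <= s <= 1 -> {for s, continuous h}) ->
  mu.-integrable `[0, 1] (EFin \o h).
Proof.
move=> ch; apply: continuous_compact_integrable; first exact: segment_compact.
apply: continuous_in_subspaceT => s; rewrite inE /= in_itv /=; exact: ch.
Qed.

Lemma Rintegral_unit_cst (c : R) : \int[mu]_(s in `[0, 1]) c = c.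
Proof.
rewrite Rintegral_cst //= lebesgue_measure_itv /= lte_fin ltr01.
by rewrite -EFinD subr0 /= mulr1.
Qed.

Lemma norm_Rintegral_unit_le (h : R -> R) (e : R) :
  (forall s, 0 <= s <= 1 -> {for s, continuous h}) ->
  (forall s, 0 <= s <= 1 -> `|h s| <= e) ->
  `|\int[mu]_(s in `[0, 1]) h s| <= e.
Proof.
move=> ch he; have ih := continuous_unit_integrable ch.
apply: le_trans (le_normr_Rintegral _ ih) _ => //.
have ce : mu.-integrable `[0, 1] (EFin \o cst e).
  by apply: continuous_unit_integrable => s s01; exact: cst_continuous.
have cn : mu.-integrable `[0, 1] (EFin \o (fun s => `|h s|)).
  apply: continuous_unit_integrable => s s01.
  by apply: (@continuous_comp _ _ _ h Num.norm); [exact: ch|exact: norm_continuous].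
rewrite -[leRHS]Rintegral_unit_cst; apply: (le_Rintegral _ cn ce) => //.
Qed.

Lemma Rintegral_unit_sum (I : Type) (r : seq I) (h : I -> R -> R) :
  (forall i s, 0 <= s <= 1 -> {for s, continuous (h i)}) ->
  (forall s, 0 <= s <= 1 -> {for s, continuous (fun s => \sum_(i <- r) h i s)}) /\
  \int[mu]_(s in `[0, 1]) (\sum_(i <- r) h i s) =
  \sum_(i <- r) \int[mu]_(s in `[0, 1]) h i s.
Proof.
move=> ch; elim: r => [|i r [cr IHr]].
  split=> [s _|].
    rewrite (_ : (fun s => _) = cst 0); first exact: cst_continuous.
    by apply/funext => t; rewrite big_nil.
  by rewrite big_nil; under eq_Rintegral do rewrite big_nil; exact: Rintegral_unit_cst.
split=> [s s01|].
  rewrite (_ : (fun s => _) = h i \+ (fun s => \sum_(j <- r) h j s)).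
    by apply: cvgD; [exact: ch|exact: cr].
  by apply/funext => t; rewrite big_cons.
rewrite big_cons -IHr; under eq_Rintegral do rewrite big_cons.
by rewrite RintegralD //; apply: continuous_unit_integrable => // s; exact: ch.
Qed.

(** The weight [s ^+ m] closes this family under differentiation: each derivative in x brings out
    one more factor s. *)
Definition avg y (m : nat) F x : R :=
  \int[mu]_(s in `[0, 1]) (s ^+ m * F (y + s *: (x - y))).

Definition star_shaped y U :=
  forall x s, U x -> 0 <= s <= 1 -> U (y + s *: (x - y)).

Section Differentiate.
Context (U : set 'rV[R]_n) (y : 'rV[R]_n).
Hypotheses (oU : open U) (sU : star_shaped y U).

Lemma continuous_avg_integrand (m : nat) F x : (forall x, U x -> {for x, continuous F}) ->
  U x -> forall s : R, 0 <= s <= 1 ->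
  {for s, continuous (fun s : R => s ^+ m * F (y + s *: (x - y)))}.
Proof.
move=> cF Ux s s01; apply: cvgM; first exact: exprn_continuous.
have cl : {for s, continuous (fun s : R => y + s *: (x - y))}.
  by apply: cvgD; [exact: cvg_cst|apply: cvgZl; exact: cvg_id].
exact: (continuous_comp cl (cF _ (sU Ux s01))).
Qed.

(** Differentiation under the integral sign: the candidate differential is L, and the integrand of
    the remainder is bounded uniformly in s by the mean value theorem and the continuity of the
    partial derivatives. *)
Lemma is_diff_avg m F x : diff_upto 2 U F -> U x ->
  differentiable (avg y m F) x /\
  forall i, partial i (avg y m F) x = avg y m.+1 (partial i F) x.
Proof.
move=> [dF pF] Ux.
have cF x' : U x' -> {for x', continuous F}.
  by move=> Ux'; exact/differentiable_continuous/dF.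
have cpF i x' : U x' -> {for x', continuous (partial i F)}.
  by move=> Ux'; apply/differentiable_continuous; exact: (pF i).1.
pose c i := avg y m.+1 (partial i F) x.
have lin : linear (fun v : 'rV[R]_n => \sum_i v ord0 i * c i : R).
  move=> a u v; rewrite scaler_sumr -big_split /=; apply: eq_bigr => i _.
  by rewrite !mxE mulrDl -mulrA.
pose L : {linear 'rV[R]_n -> R} := HB.pack
  (fun v : 'rV[R]_n => \sum_i v ord0 i * c i : R)
  (GRing.isLinear.Build _ _ _ _ _ lin).
have cL : continuous L.
  move=> v; apply: differentiable_continuous.
  have H := diff_upto_sum (index_enum 'I_n) openT (fun i => diff_uptoM openT
    (diff_upto_coord 1 i openT) (diff_upto_cst 1 (c i) openT)).
  exact: (H.1 v I).
pose V : normedModType R := 'rV[R]_n.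
pose W : normedModType R := R.
have remL : (avg y m F : V -> W) \o shift x = cst (avg y m F x) + (L : V -> W) +o_ (0 : V) id.
  apply/eqaddoP => _/posnumP[e].
  (* The n coordinates contribute [eps] each; dividing by [n.+1] also covers n = 0. *)
  pose eps := e%:num / n.+1%:R.
  have eps0 : 0 < eps by rewrite divr_gt0 // ltr0n.
  pose line (s : R) := y + s *: (x - y).
  (* Compactness of [0, 1] provides one neighbourhood of 0 that serves every point of the segment
     from y to x. *)
  have near_line : \forall w \near (0 : V), forall s : R, 0 <= s <= 1 ->
      U (line s + w) /\
      forall i, `|partial i F (line s + w) - partial i F (line s)| <= eps.
    have cov := proj1 (compact_near_coveringP _) (@segment_compact R 0 1).
    pose P (w : V) (s : R) := U (line s + w) /\
        forall i, `|partial i F (line s + w) - partial i F (line s)| <= eps.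
    suff cv : \forall w \near nbhs (0 : V), `[0, 1] `<=` P w.
      by apply: filterS cv => w H s s01; apply: H; rewrite /= in_itv.
    apply: cov => s.
    rewrite /= in_itv /= => s01.
    have Us : U (line s) by exact: sU.
    have c1 : line z.1 @[z --> (s, 0 : V)] --> line s.
      apply: cvgD; first exact: cvg_cst.
      by apply: cvgZl; exact: cvg_fst.
    have c2 : line z.1 + z.2 @[z --> (s, 0 : V)] --> line s.
      rewrite -[X in _ --> X]addr0; apply: cvgD c1 _; exact: cvg_snd.
    have nU : \forall z \near (s, 0 : V), U (line z.1 + z.2).
      by apply: c2; exact: open_nbhs_nbhs.
    have np i : \forall z \near (s, 0 : V),
        `|partial i F (line z.1 + z.2) - partial i F (line z.1)| <= eps.
      have ci := cpF i _ Us.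
      have c3 : (partial i F (line z.1 + z.2) - partial i F (line z.1))
          @[z --> (s, 0 : V)] --> (0 : R).
        rewrite -(subrr (partial i F (line s))).
        by apply: cvgB; [exact: cvg_comp c2 ci|exact: cvg_comp c1 ci].
      by move/cvgr0Pnorm_le : c3; exact.
    have fa := filter_forall _ np.
    have H : \forall z \near (s, 0 : V), P z.2 z.1.
      near=> z; split; first by near: z; exact: nU.
      by near: z; exact: fa.
    exact: H.
  have /nbhs_norm0P [d /= d0 dP] := near_line.
  have nd : \forall v \near (0 : V), `|v| < d by exact: nbhs0_lt.
  near=> v.
  have vd : `|v| < d by near: v; exact: nd.
  rewrite !fctE /=.
  have line1 : line 1 = x by rewrite /line scale1r addrC subrK.
  have Uvx : U (v + x).
    by have [|+ _] := dP v vd 1; rewrite ?ler01 ?lexx // line1 addrC.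
  have lineD (s : R) : y + s *: (v + x - y) = line s + s *: v.
    by rewrite /line -addrA scalerDr addrCA addrC.
  have cd (k : nat) f (s : R) : (forall x, U x -> {for x, continuous f}) -> 0 <= s <= 1 ->
      {for s, continuous (fun s : R => s ^+ k * f (line s))}.
    by move=> cf s01; exact: continuous_avg_integrand.
  pose h1 (s : R) := s ^+ m * F (y + s *: (v + x - y)).
  pose h2 (s : R) := s ^+ m * F (line s).
  pose h3 i (s : R) := v ord0 i * (s ^+ m.+1 * partial i F (line s)).
  have ch1 (s : R) : 0 <= s <= 1 -> {for s, continuous h1}.
    by move=> s01; exact: continuous_avg_integrand.
  have ch2 (s : R) : 0 <= s <= 1 -> {for s, continuous h2} by exact: cd.
  have ch3 i (s : R) : 0 <= s <= 1 -> {for s, continuous (h3 i)}.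
    by move=> s01; apply: cvgM; [exact: cvg_cst|exact: (cd _ _ _ (cpF i))].
  have [cs intE] := Rintegral_unit_sum (index_enum 'I_n) ch3.
  have -> : avg y m F (v + x) - (avg y m F x + \sum_i v ord0 i * c i) =
      \int[mu]_(s in `[0, 1]) (h1 s - h2 s - \sum_i h3 i s).
    have i12 : mu.-integrable `[0, 1] (EFin \o (fun s => h1 s - h2 s)).
      apply: continuous_unit_integrable => s s01.
      by apply: cvgB; [exact: ch1|exact: ch2].
    have i1 := continuous_unit_integrable ch1.
    have i2 := continuous_unit_integrable ch2.
    have i3 := continuous_unit_integrable cs.
    rewrite (RintegralB _ i12 i3) // (RintegralB _ i1 i2) //.
    rewrite intE opprD addrA; congr (_ - _); apply: eq_bigr => i _.
    rewrite /h3 RintegralZl //; apply: continuous_unit_integrable => s s01.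
    exact: (cd _ _ _ (cpF i)).
  apply: norm_Rintegral_unit_le => s s01.
    by apply: cvgB; [apply: cvgB; [exact: ch1|exact: ch2]|exact: cs].
  have normsv (t : R) : 0 <= t <= 1 -> `|t *: (s *: v)| < d.
    move=> t01; apply: le_lt_trans vd; rewrite !normrZ mulrA.
    rewrite -[leRHS]mul1r ler_wpM2r // -normrM ger0_norm ?mulr_ge0 //.
    + by rewrite mulr_ile1 //; [case/andP: t01|case/andP: s01|case/andP: t01|case/andP: s01].
    + by case/andP: t01.
    + by case/andP: s01.
  pose psi (t : R) := F (line s + t *: (s *: v)).
  pose dpsi (t : R) := 'D_(s *: v) F (line s + t *: (s *: v)).
  have dpsiP (t : R) : 0 <= t <= 1 -> is_derive t 1 psi (dpsi t).
    by move=> t01; apply/is_derive_line/dF; have [] := dP _ (normsv _ t01) s s01.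
  have dpsi_oo (t : R) : t \in `]0, 1[%R -> is_derive t 1 psi (dpsi t).
    by rewrite in_itv /= => /andP[? ?]; apply: dpsiP; rewrite !ltW.
  have cpsi : {within `[0, 1], continuous psi}.
    apply: continuous_in_subspaceT => t; rewrite inE /= in_itv /= => /dpsiP[d1 _].
    exact/differentiable_continuous/derivable1_diffP.
  have [t t01 psiE] := MVT ltr01 dpsi_oo cpsi.
  have {}t01 : 0 <= t <= 1 by move: t01; rewrite in_itv /= => /andP[? ?]; rewrite !ltW.
  have [Ut bt] := dP _ (normsv _ t01) s s01.
  have -> : h1 s - h2 s - \sum_i h3 i s = s ^+ m * s * \sum_i v ord0 i *
      (partial i F (line s + t *: (s *: v)) - partial i F (line s)).
    rewrite /h1 /h2 lineD -mulrBr.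
    have -> : F (line s + s *: v) - F (line s) = psi 1 - psi 0.
      by rewrite /psi scale1r scale0r addr0.
    rewrite psiE subr0 mulr1 /dpsi deriveE_partial; last exact: dF.
    rewrite !mulr_sumr -sumrB; apply: eq_bigr => i _.
    by rewrite !mxE /h3 exprS; ring.
  rewrite normrM -[leRHS]mul1r ler_pM //.
    rewrite ger0_norm -?exprSr ?exprn_ge0 ?exprn_ile1 //; by case/andP: s01.
  apply: le_trans (ler_norm_sum _ _ _) _.
  apply: (@le_trans _ _ (\sum_(i < n) eps * `|v|)).
    apply: ler_sum => i _; rewrite normrM mulrC ler_pM //.
    exact: ler_coord_norm.
  rewrite sumr_const card_ord -mulr_natl mulrA ler_wpM2r //.
  rewrite /eps mulrCA ger_pMr // ler_pdivrMr ?ltr0n // mul1r ler_nat //.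
have dE : 'd (avg y m F) x = L :> (_ -> _) by exact: diff_unique.
have d : differentiable (avg y m F) x.
  by apply/diff_locallyP; rewrite dE.
split=> // i; rewrite /partial deriveE // dE /= (bigD1 i) //= big1 ?addr0.
  by rewrite mxE !eqxx mul1r.
by move=> j ji; rewrite mxE (negbTE ji) andbF mul0r.
Unshelve. all: end_near.
Qed.

Lemma smooth_on_avg m F : smooth_on U F -> smooth_on U (avg y m F).
Proof.
move=> sF k; elim: k m F sF => // k IHk m F sF.
split=> [x Ux|i]; first by have [] := is_diff_avg m (sF 2) Ux.
have sp : smooth_on U (partial i F) by move=> l; have [_ p] := sF l.+1; exact: p.
apply: eq_diff_upto (IHk m.+1 _ sp) => // x Ux.
by have [_ ->] := is_diff_avg m (sF 2) Ux.
Qed.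

Lemma avg0_center F : avg y 0 F y = F y.
Proof.
rewrite -[RHS]Rintegral_unit_cst; apply: eq_Rintegral => s _.
by rewrite subrr scaler0 addr0 mul1r.
Qed.

(** Fundamental theorem of calculus for s |-> F (y + s (x - y)). The coefficients are averages, so
    [smooth_on_avg] makes them smooth when F is. *)
Lemma hadamard F x : diff_upto 2 U F -> U x ->
  F x - F y = \sum_i (x ord0 i - y ord0 i) * avg y 0 (partial i F) x.
Proof.
move=> [dF pF] Ux.
have cpF i x' : U x' -> {for x', continuous (partial i F)}.
  by move=> Ux'; apply/differentiable_continuous; exact: (pF i).1.
pose G s := F (y + s *: (x - y)).
pose g s := \sum_i (x ord0 i - y ord0 i) * (s ^+ 0 * partial i F (y + s *: (x - y))).
have dG (s : R) : 0 <= s <= 1 -> is_derive s 1 G (g s).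
  move=> s01; have Us := sU Ux s01.
  have -> : g s = 'D_(x - y) F (y + s *: (x - y)).
    rewrite deriveE_partial; last exact: dF.
    by apply: eq_bigr => i _; rewrite !mxE expr0 mul1r.
  exact/is_derive_line/dF.
have ch i (s : R) : 0 <= s <= 1 -> {for s, continuous
    (fun s : R => (x ord0 i - y ord0 i) * (s ^+ 0 * partial i F (y + s *: (x - y))))}.
  move=> s01; apply: cvgM; first exact: cvg_cst.
  exact: (continuous_avg_integrand (cpF i)).
have [cg intE] := Rintegral_unit_sum (index_enum 'I_n) ch.
have cG (s : R) : 0 <= s <= 1 -> {for s, continuous G}.
  by move=> /dG[d1 _]; exact/differentiable_continuous/derivable1_diffP.
have := @continuous_FTC2 R g G 0 1 ltr01.
have -> : (G 1)%:E = (F x)%:E by rewrite /G scale1r addrC subrK.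
have -> : (G 0)%:E = (F y)%:E by rewrite /G scale0r addr0.
move=> FTC; have {}FTC : \int[mu]_(s in `[0, 1]) g s = F x - F y.
  rewrite /Rintegral FTC //.
  - apply: continuous_in_subspaceT => s; rewrite inE /= in_itv /=; exact: cg.
  - split.
    + by move=> s; rewrite in_itv /= => /andP[? ?]; have [] := dG s _; rewrite ?ltW.
    + by apply: cvg_at_right_filter; apply: cG; rewrite lexx ler01.
    + by apply: cvg_at_left_filter; apply: cG; rewrite lexx ler01.
  - move=> s; rewrite in_itv /= => /andP[s0 s1].
    rewrite derive1E; apply: (@derive_val _ _ _ _ _ _ _ (dG s _)).
    by rewrite !ltW.
rewrite -FTC intE; apply: eq_bigr => i _.
rewrite RintegralZl //; apply: continuous_unit_integrable => s s01.
exact: (continuous_avg_integrand (cpF i)).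
Qed.

End Differentiate.
End Average.

(** * Smooth functions and vector fields on a manifold *)

Lemma open_within_preimage (S T : topologicalType) (A : set S) (f : S -> T) (B : set T) :
  open A -> {within A, continuous f} -> open B -> open (A `&` f @^-1` B).
Proof.
move=> oA cf oB; rewrite openE => x [Ax Bx].
have cx : {for x, continuous f}.
  by move: cf; rewrite continuous_open_subspace // => /(_ x); apply; rewrite inE.
apply: filterI; first exact: open_nbhs_nbhs.
by apply: cx; exact: open_nbhs_nbhs.
Qed.

Section SmoothFunEval.
Context {R : realType} {n : nat} {M : manifold R n}.
Implicit Types (f g : smooth_fun M) (X Y : vfield M) (p : M).

Lemma smooth_funE f g : (forall p, f p = g p) -> f = g.
Proof. by move=> fg; apply: val_inj; exact/funext. Qed.

Lemma sfD f g p : (f + g) p = f p + g p. Proof. by []. Qed.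
Lemma sfM f g p : (f * g) p = f p * g p. Proof. by []. Qed.
Lemma sfN f p : (- f) p = - f p. Proof. by []. Qed.
Lemma sf0 p : (0 : smooth_fun M) p = 0. Proof. by []. Qed.
Lemma sf1 p : (1 : smooth_fun M) p = 1. Proof. by []. Qed.
Lemma sf_sum (I : Type) (r : seq I) (F : I -> smooth_fun M) p :
  (\sum_(i <- r) F i) p = \sum_(i <- r) F i p.
Proof. by elim/big_rec2: _ => // i x y _ <-. Qed.

Definition sfE := (sfD, sfM, sfN, sf0, sf1, sf_sum).

Lemma const_fun1 : const_fun M 1 = 1. Proof. exact: val_inj. Qed.

Lemma vfieldM X f g : X (f * g) = X f * g + f * X g :> smooth_fun M.
Proof. by have /asboolP[_] := vfieldP X; exact. Qed.

Lemma vfield_lin X c f g :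
  X (const_fun M c * f + g) = const_fun M c * X f + X g :> smooth_fun M.
Proof. by have /asboolP[+ _] := vfieldP X; exact. Qed.

Lemma vfieldD X f g : X (f + g) = X f + X g :> smooth_fun M.
Proof. by have := vfield_lin X 1 f g; rewrite const_fun1 !mul1r. Qed.

Lemma vfield0 X : X 0 = 0 :> smooth_fun M.
Proof. by apply: (addIr (X 0 : smooth_fun M)); rewrite -vfieldD !add0r. Qed.

Lemma vfieldN X f : X (- f) = - (X f : smooth_fun M) :> smooth_fun M.
Proof.
by apply: (addIr (X f : smooth_fun M)); rewrite -vfieldD !addNr vfield0.
Qed.

Lemma vfield_const X c : X (const_fun M c) = 0 :> smooth_fun M.
Proof.
have X1 : X 1 = 0 :> smooth_fun M.
  apply: (addIr (X 1 : smooth_fun M)).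
  by rewrite add0r -{3}[1](mulr1 1) vfieldM mulr1 mul1r.
by have := vfield_lin X c 1 0; rewrite vfield0 X1 !mulr0 !addr0 mulr1.
Qed.

Lemma vfield_sum X (I : Type) (r : seq I) (F : I -> smooth_fun M) :
  X (\sum_(i <- r) F i) = \sum_(i <- r) (X (F i) : smooth_fun M) :> smooth_fun M.
Proof.
elim: r => [|i r IHr]; first by rewrite !big_nil vfield0.
by rewrite !big_cons vfieldD IHr.
Qed.

Lemma vfield_eq X Y : (forall f p, X f p = Y f p) -> X = Y.
Proof.
by move=> XY; apply: val_inj; apply/funext => f; apply: smooth_funE => p; exact: XY.
Qed.

Lemma vfDE X Y f : (X + Y) f = X f + Y f :> smooth_fun M. Proof. by []. Qed.
Lemma vfZE h X f : (h *: X) f = h * X f :> smooth_fun M. Proof. by []. Qed.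
Lemma vf0E f : (0 : vfield M) f = 0 :> smooth_fun M. Proof. by []. Qed.
Lemma vf_sumE (I : Type) (r : seq I) (F : I -> vfield M) f :
  (\sum_(i <- r) F i) f = \sum_(i <- r) (F i f : smooth_fun M) :> smooth_fun M.
Proof. by elim/big_rec2: _ => // i x y _ <-. Qed.

End SmoothFunEval.

Section Extension.
Context {R : realType} {n : nat} {M : manifold R n}.
Variables (c : chart R n M) (U K : set 'rV[R]_n).
Hypotheses (Ac : atlas c) (oU : open U) (Uc : U `<=` chart_img c).
Hypotheses (cK : compact K) (KU : K `<=` U).

Definition in_chart (q : M) := `[< chart_dom c q /\ U (chart_map c q) >].

Definition extend (h : 'rV[R]_n -> R) (q : M) : R :=
  if in_chart q then h (chart_map c q) else 0.

(** Near a point of the chart region over U the extension is h in coordinates. Elsewhere it vanishes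
    on the complement of the image of K, which is open because that image is compact in a Hausdorff
    space. *)
Lemma extend_smooth h : smooth_on U h -> (forall x, U x -> ~ K x -> h x = 0) ->
  extend h \in smooth (M := M).
Proof.
move=> sh h0; apply/asboolP => d Ad k.
have odi := @chart_img_open _ _ _ d.
have ciK : compact (chart_inv c @` K).
  apply: continuous_compact => //; apply: continuous_subspaceW (@chart_inv_cont _ _ _ c).
  exact: subset_trans KU Uc.
have clK : closed (chart_inv c @` K).
  exact: compact_closed (@manifold_hausdorff _ _ M) ciK.
apply: diff_upto_local => x dx; case: (boolP (in_chart (chart_inv d x))) => [/asboolP[cx Ux]|nU].
- pose W := chart_img d `&` chart_inv d @^-1`
     (chart_dom c `&` chart_map c @^-1` U).
  have oW : open W.
    apply: open_within_preimage (@chart_inv_cont _ _ _ d) _ => //.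
    exact: open_within_preimage (@chart_dom_open _ _ _ c) (@chart_map_cont _ _ _ c) oU.
  exists W => //.
  have : diff_upto k W (h \o (chart_map c \o chart_inv d)).
    apply: (diff_upto_comp oW _ _ (sh k)) => [z [_ []] //|j].
    apply: diff_upto_sub (atlas_compat Ad Ac j k) => z [dz [cz _]]; by split.
  apply: eq_diff_upto => // z [dz [cz Uz]].
  by rewrite /= /extend ifT //; apply/asboolP; split.
- pose W := chart_img d `&` chart_inv d @^-1` (~` (chart_inv c @` K)).
  have oW : open W.
    apply: open_within_preimage (@chart_inv_cont _ _ _ d) _ => //.
    exact: closed_openC.
  have ext0 z : W z -> extend h (chart_inv d z) = 0.
    move=> [dz nK]; rewrite /extend; case: ifPn => // /asboolP[cz Uz].
    apply: h0 => // Kz; apply: nK; exists (chart_map c (chart_inv d z)) => //.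
    exact: chart_mapK.
  exists W.
    split=> // -[y Ky yE]; move/asboolP: nU; apply.
    rewrite /= -yE chart_invK; last exact/Uc/KU.
    by split; [apply/chart_inv_dom/Uc/KU|exact: KU].
  apply: eq_diff_upto (diff_upto0 k oW) => // z Wz.
  by rewrite /= ext0.
Qed.

End Extension.

Lemma rV_norm_le (R : realType) n (v : 'rV[R]_n) (e : R) :
  0 <= e -> (forall i, `|v ord0 i| <= e) -> `|v| <= e.
Proof.
move=> e0 ve; rewrite [leLHS]/Num.norm /= mx_normrE.
by apply: bigmax_le => // -[i j] _ /=; rewrite (ord1 i).
Qed.

Lemma star_shaped_ball (R : realType) n (a y : 'rV[R]_n) (r : R) :
  ball a r y -> star_shaped y (ball a r).
Proof.
move=> + x s; rewrite -ball_normE /= => ay ax /andP[s0 s1].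
have -> : a - (y + s *: (x - y)) = (1 - s) *: (a - y) + s *: (a - x).
  by apply/rowP => i; rewrite !mxE; ring.
have s1' : 0 <= 1 - s by rewrite subr_ge0.
apply: le_lt_trans (ler_normD _ _) _; rewrite !normrZ !ger0_norm //.
have [->|sn1] := eqVneq s 1; first by rewrite subrr mul0r add0r mul1r.
have sl1 : 0 < 1 - s by rewrite subr_gt0 lt_neqAle sn1.
have -> : r = (1 - s) * r + s * r by ring.
by apply: ltr_leD; [rewrite ltr_pM2l|rewrite ler_wpM2l // ltW].
Qed.

(** * Cut-off coordinate fields as a local frame *)

Section LocalFrame.
Context {R : realType} {n : nat} {M : manifold R n}.
Variables (c : chart R n M) (a : 'rV[R]_n) (r : R).
Hypotheses (Ac : atlas c) (r0 : 0 < r) (Uc : ball a r `<=` chart_img c).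

Local Notation U := (ball a r).
(** The radius is halved so that the closed cube supporting the bump lies inside the open ball of
    radius r. *)
Let K := [set x : 'rV[R]_n | forall i, `|x ord0 i - a ord0 i| <= r / 2].
Let b := ball_bump a (r / 2).
Local Notation W := (in_chart c U).

Let r20 : 0 < r / 2. Proof. by rewrite divr_gt0. Qed.
Let oU : open U. Proof. exact: ball_open. Qed.

Let KU : K `<=` U.
Proof.
move=> x Kx; rewrite -ball_normE /=.
apply: (@le_lt_trans _ _ (r / 2)); last by rewrite ltr_pdivrMr // ltr_pMr // ltr1n.
by apply: rV_norm_le => [|i]; [exact: ltW|rewrite !mxE distrC].
Qed.

Let b_out x : U x -> ~ K x -> b x = 0.
Proof.
by move=> _ Kx; apply/eqP/negPn/negP => /(ball_bump_support r20)/Kx.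
Qed.

Fact cutoff_smooth h : smooth_on U h ->
  extend c U (fun x => b x * h x) \in smooth (M := M).
Proof.
move=> sh; apply: (@extend_smooth _ _ _ _ _ K) => //.
- exact: compact_cube.
- by move=> k; exact: (diff_uptoM oU (smooth_on_ball_bump a (r / 2) oU k) (sh k)).
- by move=> x Ux Kx; rewrite b_out // mul0r.
Qed.

Definition cutoff h (sh : smooth_on U h) : smooth_fun M :=
  SmoothFun (cutoff_smooth sh).

Lemma cutoffE h (sh : smooth_on U h) q :
  cutoff sh q = if W q then b (chart_map c q) * h (chart_map c q) else 0.
Proof. by []. Qed.

Lemma smooth_on_coord i : smooth_on U (fun x => x ord0 i).
Proof. by move=> k; exact: diff_upto_coord. Qed.

Lemma smooth_on_one : smooth_on U (fun=> 1 : R).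
Proof. by move=> k; exact: diff_upto_cst. Qed.

Definition loc (f : smooth_fun M) := f \o chart_inv c.

Lemma smooth_on_loc f : smooth_on U (loc f).
Proof.
have /asboolP sf := smooth_funP f.
by move=> k; exact: diff_upto_sub (sf c Ac k).
Qed.

Lemma smooth_on_partial h i : smooth_on U h -> smooth_on U (partial i h).
Proof. by move=> sh k; have [_] := sh k.+1; exact. Qed.

Lemma loc_diff f x : U x -> differentiable (loc f) x.
Proof. by have [d _] := smooth_on_loc f 1; exact: d. Qed.

(** Vector fields act on global functions only, so the constant 1, the coordinates and the partial
    derivatives are all multiplied by the bump b and extended by zero. *)
Definition chi := cutoff smooth_on_one.
Definition coordf i := cutoff (smooth_on_coord i).
Definition dloc i f := cutoff (smooth_on_partial i (smooth_on_loc f)).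

Lemma chiE q : chi q = if W q then b (chart_map c q) else 0.
Proof. by rewrite cutoffE mulr1. Qed.

Lemma locK f q : W q -> loc f (chart_map c q) = f q.
Proof. by move=> /asboolP[cq _]; rewrite /loc /= chart_mapK. Qed.

Fact dloc_derivation i : (dloc i : smooth_fun M -> (smooth_fun M)^o) \in derivation (M := M).
Proof.
apply/asboolP; split=> [k f g|f g]; apply: smooth_funE => q.
  rewrite !sfE !cutoffE; case: ifPn => Wq; last by rewrite mulr0 addr0.
  have /asboolP[cq Uq] := Wq.
  have -> : partial i (loc (const_fun M k * f + g)) (chart_map c q) =
     k * partial i (loc f) (chart_map c q) + partial i (loc g) (chart_map c q).
    have -> : loc (const_fun M k * f + g) = k *: loc f + loc g by [].
    rewrite /partial deriveD ?deriveZ //; 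
      try by apply: diff_derivable; try apply: differentiableZ; exact: loc_diff.
  by rewrite /= mulrDr mulrCA.
rewrite !sfE !cutoffE; case: ifPn => Wq; last by rewrite mul0r mulr0 addr0.
have /asboolP[cq Uq] := Wq.
have -> : partial i (loc (f * g)) (chart_map c q) =
   f q * partial i (loc g) (chart_map c q) + g q * partial i (loc f) (chart_map c q).
  rewrite -(locK f Wq) -(locK g Wq).
  have -> : loc (f * g) = loc f * loc g by [].
  by rewrite /partial deriveM //; apply: diff_derivable; exact: loc_diff.
ring.
Qed.

Definition frame i : vfield M := VField (dloc_derivation i).

Lemma frameE i f q : frame i f q =
  if W q then b (chart_map c q) * partial i (loc f) (chart_map c q) else 0.
Proof. by []. Qed.

Lemma near_loc_cutoff h (sh : smooth_on U h) x : U x ->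
  \near x, b x * h x = loc (cutoff sh) x.
Proof.
move=> Ux; near=> z.
have Uz : U z by near: z; exact: open_nbhs_nbhs.
rewrite -[loc _ z]/(cutoff sh (chart_inv c z)) cutoffE chart_invK; last exact: Uc.
rewrite ifT //; apply/asboolP; rewrite chart_invK; last exact: Uc.
by split=> //; apply: chart_inv_dom; exact: Uc.
Unshelve. all: by end_near. Qed.

Lemma b_diff x : differentiable b x.
Proof. by have [d _] := smooth_on_ball_bump a (r / 2) openT 1; exact: d. Qed.

Lemma frame_coordf i j q : W q ->
  frame i (coordf j) q = (i == j)%:R * b (chart_map c q) ^+ 2
    + chart_map c q ord0 j * frame i chi q.
Proof.
move=> Wq; have /asboolP[cq Uq] := Wq; rewrite !frameE Wq.
rewrite -(partial_near_eq i (near_loc_cutoff (smooth_on_coord j) Uq)).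
rewrite -(partial_near_eq i (near_loc_cutoff smooth_on_one Uq)).
have -> : (fun x => b x * 1) = b by apply/funext => x; rewrite mulr1.
have -> : partial i (fun x => b x * x ord0 j) (chart_map c q) =
  b (chart_map c q) * partial i (fun x => x ord0 j) (chart_map c q) + 
  chart_map c q ord0 j * partial i b (chart_map c q).
  rewrite /partial; apply: (@deriveM _ _ b (fun x => x ord0 j)).
    exact/diff_derivable/b_diff.
  exact/diff_derivable/differentiable_coord.
by rewrite partial_coord; ring.
Qed.

(* Multiply Hadamard's formula at q for f by chi^2, so that it becomes an identity
   between global smooth functions, and apply the derivation X. *)
Lemma vfield_chart (X : vfield M) f q : W q ->
  chi q ^+ 2 * X f q = chi q * \sum_i partial i (loc f) (chart_map c q) *
    (X (coordf i) q - chart_map c q ord0 i * X chi q).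
Proof.
move=> Wq; have /asboolP[cq Uq] := Wq.
set y := chart_map c q.
have sU := star_shaped_ball Uq.
have sG i : smooth_on U (avg y 0 (partial i (loc f))).
  apply: smooth_on_avg => //; exact/smooth_on_partial/smooth_on_loc.
have E : chi * chi * (f - const_fun M (f q)) =
    \sum_i (coordf i - const_fun M (y ord0 i) * chi) * cutoff (sG i).
  apply: smooth_funE => z; rewrite sf_sum.
  under eq_bigr do rewrite !sfE.
  rewrite !sfE; case: (boolP (W z)) => Wz; last first.
    rewrite chiE (negbTE Wz) !mul0r big1 // => i _.
    by rewrite !cutoffE (negbTE Wz) mulr0.
  have /asboolP[cz Uz] := Wz.
  have H := hadamard sU (smooth_on_loc f 2) Uz.
  rewrite -(locK f Wz) -[const_fun M (f q) z]/(f q) -(locK f Wq) H !chiE Wz.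
  rewrite mulr_sumr; apply: eq_bigr => i _; rewrite !cutoffE Wz /=; ring.
(* Both f - f(q) and [coordf i - const_fun M (y ord0 i) * chi] vanish at q, so one Leibniz term
   survives on each side, and at q the average is the partial derivative. *)
have := congr1 (fun h : smooth_fun M => (X h : smooth_fun M) q) E.
rewrite vfieldM vfieldD vfieldN vfield_const vfield_sum !sfE.
rewrite -[const_fun M (f q) q]/(f q) subrr mulr0 add0r subr0 -expr2 => ->.
rewrite mulr_sumr; apply: eq_bigr => i _.
rewrite vfieldM vfieldD vfieldN vfieldM vfield_const !sfE.
rewrite cutoffE Wq avg0_center chiE Wq cutoffE Wq /=; ring.
Qed.

(** Formally chi^2 times the i-th component of X: with [coordf i] = chi x_i the terms in X chi
    cancel. As [frame i] carries another factor chi, [frame_span] has chi^3. *)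
Definition coef (X : vfield M) i : smooth_fun M := chi * X (coordf i) - coordf i * X chi.

Lemma frame_span X : (chi * chi * chi) *: X = \sum_i coef X i *: frame i.
Proof.
apply: vfield_eq => f q; rewrite vf_sumE sf_sum.
rewrite vfZE !sfE; case: (boolP (W q)) => Wq; last first.
  rewrite chiE (negbTE Wq) !mul0r big1 // => i _.
  by rewrite vfZE !sfE frameE (negbTE Wq) mulr0.
have := vfield_chart X f Wq; move=> H.
have -> : chi q * chi q * chi q * X f q = chi q * (chi q ^+ 2 * X f q) by ring.
rewrite H mulrA mulr_sumr; apply: eq_bigr => i _.
by rewrite vfZE !sfE frameE Wq chiE Wq cutoffE Wq /=; ring.
Qed.

(** Test the relation on chi (x_j - x_j(q)): by [frame_coordf] only the j-th field is nonzero on it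
    at q, with value b^2. *)
Lemma frame_free q (u : 'I_n -> R) : chi q != 0 ->
  \sum_i u i *: at_point q (frame i) = 0 -> forall i, u i = 0.
Proof.
move=> cq0; have Wq : W q by move: cq0; rewrite chiE; case: ifP; rewrite ?eqxx.
move=> H j.
have Hf f : \sum_i u i * frame i f q = 0.
  by have := congr1 (fun h => h f) H; rewrite fct_sumE.
have := Hf (coordf j - const_fun M (chart_map c q ord0 j) * chi).
under eq_bigr => i _.
  rewrite vfieldD vfieldN vfieldM vfield_const !sfE mul0r add0r frame_coordf //.
  rewrite addrK; over.
rewrite (bigD1 j) //= big1 ?addr0 => [|i ij]; last by rewrite (negbTE ij) mul0r mulr0.
rewrite eqxx mul1r => /eqP; rewrite mulf_eq0 expf_eq0 /=.
by move: cq0; rewrite chiE Wq => /negbTE->; rewrite orbF => /eqP.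
Qed.

End LocalFrame.

(** The factor w is kept so that the expansion is an identity between global vector fields, to which
    maps linear over the smooth functions can be applied. *)
Lemma local_frame (R : realType) n (M : manifold R n) (p : M) :
  exists (E : 'I_n -> vfield M) (w : smooth_fun M) (u : vfield M -> 'I_n -> smooth_fun M),
  [/\ w p != 0, forall X, w *: X = \sum_i u X i *: E i & basis_at p E].
Proof.
have [c Ac cp] := atlas_cover p.
have oc := @chart_img_open _ _ _ c.
have := open_nbhs_nbhs (conj oc (chart_map_img cp)).
rewrite -nbhs_ballE => -[r /= r0 Uc].
set a := chart_map c p in Uc.
have pW : in_chart c (ball a r) p by apply/asboolP; split=> //; exact: ballxx.
have chi0 : chi Ac r0 Uc p != 0.
  by rewrite chiE pW gt_eqF // ball_bump_center // divr_gt0.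
set w := chi Ac r0 Uc * chi Ac r0 Uc * chi Ac r0 Uc.
have w0 : w p != 0 by rewrite !sfE !mulf_neq0.
exists (frame Ac r0 Uc), (w), (coef Ac r0 Uc); split=> //.
  exact: frame_span.
split=> [u|X]; first exact: frame_free.
exists (fun i => coef Ac r0 Uc X i p / (w) p).
apply/funext => f.
have := congr1 (fun Y : vfield M => (Y f : smooth_fun M) p) (frame_span Ac r0 Uc X).
rewrite vf_sumE sf_sum vfZE sfM => /(canRL (mulKf w0)) XE.
rewrite /at_point XE fct_sumE mulr_sumr; apply: eq_bigr => i _.
by rewrite vfZE sfM mulrA [_^-1 * _]mulrC.
Qed.

Lemma scalar0 (K : comPzRingType) (V : lmodType K) (T : V -> K) :
  scalar T -> T 0 = 0.
Proof.
move=> sT; apply: (addIr (T 0)).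
by have := sT 1 0 0; rewrite scaler0 addr0 mul1r add0r => <-.
Qed.

Lemma scalar_sum (K : comPzRingType) (V : lmodType K) (T : V -> K) :
  scalar T -> forall (I : Type) (r : seq I) (u : I -> K) (E : I -> V),
  T (\sum_(i <- r) u i *: E i) = \sum_(i <- r) u i * T (E i).
Proof.
move=> sT I r u E; elim: r => [|i r IHr]; first by rewrite !big_nil scalar0.
by rewrite !big_cons sT IHr.
Qed.

(** * Tensoriality, traces and gluing of quotients *)

Section Pointwise.
Context {R : realType} {n : nat} {M : manifold R n}.
Implicit Types (p : M) (X Y Z : vfield M) (T : vfield M -> smooth_fun M).

Lemma at_pointD p X Y : at_point p (X + Y) = at_point p X + at_point p Y.
Proof. by []. Qed.

Lemma at_pointN p X : at_point p (- X) = - at_point p X.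
Proof. by []. Qed.

Lemma at_pointZ p (f : smooth_fun M) X : at_point p (f *: X) = f p *: at_point p X.
Proof. by []. Qed.

Lemma at_point_sum p (I : Type) (r : seq I) (F : I -> vfield M) :
  at_point p (\sum_(i <- r) F i) = \sum_(i <- r) at_point p (F i).
Proof. by elim/big_rec2: _ => // i x y _ <-. Qed.

Lemma at_point_eq0 X : (forall p, at_point p X = 0) -> X = 0.
Proof. by move=> H; apply: vfield_eq => f p; exact: (congr1 (fun h => h f) (H p)). Qed.

(** Apply T to [w *: X = \sum_i u X i *: E i]: the coefficients vanish at p by freeness of the
    frame, and w(p) is nonzero. *)
Lemma at_point_tensorial T : scalar T ->
  forall p X, at_point p X = 0 -> T X p = 0.
Proof.
move=> sT p X X0.
have [E [w [u [w0 wE [Efree _]]]]] := local_frame p.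
have u0 : forall i, u X i p = 0.
  apply: Efree; have := congr1 (at_point p) (wE X).
  by rewrite at_point_sum at_pointZ X0 scaler0.
have TwX : w * T X = \sum_i u X i * T (E i).
  by rewrite -scalar_sum // -wE; have := sT w X 0; rewrite (scalar0 sT) !addr0.
have := congr1 (fun f : smooth_fun M => f p) TwX.
rewrite sf_sum big1 => [|i _]; last by rewrite sfM u0 mul0r.
by rewrite sfM => /eqP; rewrite mulf_eq0 (negbTE w0) => /eqP.
Qed.

Lemma at_point_tensorial_lin T : scalar T ->
  forall p X (I : Type) (r : seq I) (u : I -> R) (E : I -> vfield M),
  at_point p X = \sum_(i <- r) u i *: at_point p (E i) ->
  T X p = \sum_(i <- r) u i * T (E i) p.
Proof.
move=> sT p X I r u E XE.
have : T (\sum_(i <- r) const_fun M (u i) *: E i + (-1) *: X) p = 0.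
  apply: at_point_tensorial => //.
  rewrite at_pointD at_pointZ at_point_sum XE sfN sf1 scaleN1r.
  by under eq_bigr do rewrite at_pointZ; rewrite subrr.
rewrite addrC sT sfD sfM sfN sf1 scalar_sum // sf_sum mulN1r addrC => /subr0_eq <-.
by apply: eq_bigr => i _.
Qed.

(** Trace of a multiple of the identity plus m rank-one operators. Every admissible basis gives this
    value and [local_frame] supplies one, so [xget] does not return its default. *)
Lemma trace_rank (A : vfield M -> vfield M) (h : smooth_fun M) (m : nat)
    (al : 'I_m -> vfield M -> smooth_fun M) (W : 'I_m -> vfield M) p :
  (forall k, scalar (al k)) -> (forall Z, A Z = h *: Z + \sum_k al k Z *: W k) ->
  trace A p = h p *+ n + \sum_k al k (W k) p.
Proof.
move=> sal AE; rewrite /trace.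
have uniq_trace t : (exists (E : 'I_n -> vfield M) (a : 'M[R]_n),
    [/\ basis_at p E,
        forall j, at_point p (A (E j)) = \sum_i a i j *: at_point p (E i)
      & t = \tr a]) -> t = h p *+ n + \sum_k al k (W k) p.
  move=> [E [a [[Efree Espan] aE ->]]].
  have /choice [x xE] : forall k, exists x : 'I_n -> R,
      at_point p (W k) = \sum_i x i *: at_point p (E i) by move=> k; exact: Espan.
  have aE' i j : a i j = h p *+ (i == j) + \sum_k al k (E j) p * x k i.
    apply/eqP; rewrite -subr_eq0; apply/eqP; move: i.
    apply: (Efree (fun i => a i j - (h p *+ (i == j) + \sum_k al k (E j) p * x k i))).
    under eq_bigr do rewrite scalerBl scalerDl.
    rewrite sumrB -aE AE at_pointD at_pointZ at_point_sum big_split /=.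
    have -> : \sum_i (h p *+ (i == j)) *: at_point p (E i) = h p *: at_point p (E j).
      rewrite (bigD1 j) //= eqxx mulr1n big1 ?addr0 // => i /negbTE ij.
      by rewrite ij mulr0n scale0r.
    rewrite opprD addrACA subrr add0r; apply/eqP; rewrite subr_eq0; apply/eqP.
    under eq_bigr => k _ do rewrite at_pointZ xE scaler_sumr.
    rewrite exchange_big /=; apply: eq_bigr => i _.
    by rewrite scaler_suml; apply: eq_bigr => k _; rewrite scalerA.
  rewrite /mxtrace; under eq_bigr do rewrite aE' eqxx mulr1n.
  rewrite big_split /= sumr_const card_ord; congr (_ + _).
  rewrite exchange_big /=; apply: eq_bigr => k _.
  rewrite (at_point_tensorial_lin (sal k) (xE k)).
  by apply: eq_bigr => i _; rewrite mulrC.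
have [E [w [u [w0 wE [Efree Espan]]]]] := local_frame p.
have /choice [a aE] : forall j, exists a : 'I_n -> R,
      at_point p (A (E j)) = \sum_i a i *: at_point p (E i) by move=> j; exact: Espan.
apply: uniq_trace; set P := (P in xget 0 P).
suff : P (xget 0 P) by [].
apply: xgetPex.
exists (\tr (\matrix_(i, j) a j i)), E, (\matrix_(i, j) a j i); split=> // j.
by rewrite aE; apply: eq_bigr => i _; rewrite mxE.
Qed.

(** The quotients a_i / d_i agree wherever both are defined, and near each point c is a single one
    of them, hence smooth. The outer factors d make both equations void where a denominator
    vanishes, since a_i is arbitrary there. *)
Lemma glue_quotients (I : Type) (a d : I -> smooth_fun M) :
  (forall p, exists i, d i p != 0) ->
  (forall i j, d i * d j * (d i * a j - d j * a i) = 0) ->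
  exists c : smooth_fun M, forall i, d i * (d i * c - a i) = 0.
Proof.
move=> /choice [i iP] compat.
have compatp j k p : d j p != 0 -> d k p != 0 -> a j p / d j p = a k p / d k p.
  move=> dj dk; have := congr1 (fun f : smooth_fun M => f p) (compat j k).
  rewrite !sfE => /eqP; rewrite !mulf_eq0 (negbTE dj) (negbTE dk) /= subr_eq0.
  by move=> /eqP H; apply/eqP; rewrite eqr_div // mulrC -H mulrC.
pose c p := a (i p) p / d (i p) p.
have cE j p : d j p != 0 -> c p = a j p / d j p by move=> dj; exact: compatp.
have sc : c \in smooth (M := M).
  apply/asboolP => e Ae k; have oe := @chart_img_open _ _ _ e.
  apply: diff_upto_local => x ex.
  set j := i (chart_inv e x).
  have /asboolP /(_ e Ae) sd := smooth_funP (d j).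
  have /asboolP /(_ e Ae) sa := smooth_funP (a j).
  pose V := chart_img e `&` (d j \o chart_inv e) @^-1` [set t | t != 0].
  have oV : open V.
    have cdj : {within chart_img e, continuous (d j \o chart_inv e)}; last first.
      exact: (open_within_preimage oe cdj (open_neq (y := 0))).
    apply: continuous_in_subspaceT => z; rewrite inE => ez.
    by apply: differentiable_continuous; have [H _] := sd 1; exact: H.
  exists V; first by split=> //; exact: iP.
  have Ve : V `<=` chart_img e by move=> ? [].
  have := diff_uptoM oV (diff_upto_sub Ve (sa k))
    (diff_uptoV oV (fun z (Vz : V z) => Vz.2) (diff_upto_sub Ve (sd k))).
  apply: eq_diff_upto => // z [ez dz].
  by rewrite !fctE /= (cE j).
exists (SmoothFun sc) => j; apply: smooth_funE => p; rewrite !sfE.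
have [->|dj] := eqVneq (d j p) 0; first by rewrite mul0r.
by rewrite -[SmoothFun sc p]/(c p) (cE j p dj) mulrCA divff // mulr1 subrr mulr0.
Qed.

(** The coordinates of n+1 vectors form an (n+1) x n matrix, whose left kernel is nonzero. *)
Lemma at_point_dependent p (X : 'I_n.+1 -> vfield M) :
  exists2 v : 'I_n.+1 -> R, \sum_i v i *: at_point p (X i) = 0 & exists i, v i != 0.
Proof.
have [E [_ [_ [_ _ [_ Espan]]]]] := local_frame p.
have /choice [x xE] : forall k, exists x : 'I_n -> R,
    at_point p (X k) = \sum_i x i *: at_point p (E i) by move=> k; exact: Espan.
pose A := \matrix_(k < n.+1, i < n) x k i.
have kA : kermx A != 0.
  rewrite -mxrank_eq0 mxrank_ker -lt0n subn_gt0 ltnS; exact: rank_leq_col.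
have /rowV0Pn [v /sub_kermxP vA v0] := kA.
exists (fun k => v ord0 k); last first.
  move/rV0Pn : v0 => [k vk]; by exists k.
under eq_bigr do rewrite xE scaler_sumr.
rewrite exchange_big big1 //= => i _.
under eq_bigr do rewrite scalerA.
rewrite -scaler_suml.
suff -> : \sum_k v ord0 k * x k i = 0 by rewrite scale0r.
have := congr1 (fun B : 'rV_n => B ord0 i) vA; rewrite mxE [RHS]mxE => vAi; rewrite -[RHS]vAi.
by apply: eq_bigr => k _; rewrite !mxE.
Qed.

End Pointwise.

(** * Tensor calculus on a Kenmotsu manifold *)

(* The calculus of vector fields on a Kenmotsu manifold: C stands for the ring
   of smooth functions, XM for the C-module of vector fields, D X f for X f. *)
Record kenmotsu_algebra (C : comPzRingType) (XM : lmodType C)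
  (D : XM -> C -> C) (br : XM -> XM -> XM) (g : XM -> XM -> C)
  (nab : XM -> XM -> XM) (phi : XM -> XM) (xi : XM) (eta : XM -> C) : Prop := {
  ka_Dadd : forall X f h, D X (f + h) = D X f + D X h;
  ka_DM : forall X f h, D X (f * h) = D X f * h + f * D X h;
  ka_Daddl : forall X Y f, D (X + Y) f = D X f + D Y f;
  ka_DZl : forall h X f, D (h *: X) f = h * D X f;
  ka_Dbr : forall X Y f, D (br X Y) f = D X (D Y f) - D Y (D X f);
  ka_jacobi : forall X Y Z, br X (br Y Z) + br Y (br Z X) + br Z (br X Y) = 0;
  ka_reduced : forall f : C, f * f = 0 -> f = 0;
  ka_torsion_free : forall n (f : C), f *+ n.+1 = 0 -> f = 0;
  ka_gl : forall Y, scalar (g^~ Y);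
  ka_gC : forall X Y, g X Y = g Y X;
  ka_g_nondeg : forall X, (forall W, g X W = 0) -> X = 0;
  ka_nabl : forall Z, linear (nab^~ Z);
  ka_nabD : forall X Y Z, nab X (Y + Z) = nab X Y + nab X Z;
  ka_nabZ : forall X f Y, nab X (f *: Y) = D X f *: Y + f *: nab X Y;
  ka_brE : forall X Y, br X Y = nab X Y - nab Y X;
  ka_Dg : forall X Y Z, D X (g Y Z) = g (nab X Y) Z + g Y (nab X Z);
  ka_phil : linear phi;
  ka_etal : scalar eta;
  ka_phi_phi : forall X, phi (phi X) = - X + eta X *: xi;
  ka_eta_xi : eta xi = 1;
  ka_g_phi_phi : forall X Y, g (phi X) (phi Y) = g X Y - eta X * eta Y;
  ka_nab_phi : forall X Y,
    nab X (phi Y) - phi (nab X Y) = g (phi X) Y *: xi - eta Y *: phi X }.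

Section KenmotsuAlgebra.
Context (C : comPzRingType) (XM : lmodType C)
  (D : XM -> C -> C) (br : XM -> XM -> XM) (g : XM -> XM -> C)
  (nab : XM -> XM -> XM) (phi : XM -> XM) (xi : XM) (eta : XM -> C)
  (HK : kenmotsu_algebra D br g nab phi xi eta).
Implicit Types (X Y Z W U : XM) (f h : C).

Let Dadd := ka_Dadd HK.
Let DM := ka_DM HK.
Let Daddl := ka_Daddl HK.
Let DZl := ka_DZl HK.
Let Dbr := ka_Dbr HK.
Let jacobi := ka_jacobi HK.
Let reduced := ka_reduced HK.
Let torsion_free := ka_torsion_free HK.
Let gl := ka_gl HK.
Let gC := ka_gC HK.
Let g_nondeg := ka_g_nondeg HK.
Let nabl := ka_nabl HK.
Let nabD := ka_nabD HK.
Let nabZ := ka_nabZ HK.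
Let brE := ka_brE HK.
Let Dg := ka_Dg HK.
Let phil := ka_phil HK.
Let etal := ka_etal HK.
Let phi_phi := ka_phi_phi HK.
Let eta_xi := ka_eta_xi HK.
Let g_phi_phi := ka_g_phi_phi HK.
Let nab_phi0 := ka_nab_phi HK.

(** Pairing with an arbitrary W turns identities of vector fields into identities of functions,
    which [ring] can settle. *)
Lemma vec_eq X Y : (forall W, g X W = g Y W) -> X = Y.
Proof.
move=> H; apply/subr0_eq/g_nondeg => W.
have /= := gl W (-1) Y X; rewrite scaleN1r [- Y + X]addrC => ->.
by rewrite mulN1r H addNr.
Qed.

(** The coefficient k is a certificate that the goal follows linearly from a known equation; what
    remains is a ring identity. *)
Lemma eq_comb k a b l r : l = r -> a - b = k * (l - r) -> a = b :> C.
Proof. by move=> ->; rewrite subrr mulr0 => /subr0_eq. Qed.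

Lemma eq_comb2 k m a b l r l' r' : l = r -> l' = r' ->
  a - b = k * (l - r) + m * (l' - r') -> a = b :> C.
Proof. by move=> -> ->; rewrite !subrr !mulr0 addr0 => /subr0_eq. Qed.

Let scalarE (T : XM -> C) : scalar T -> [/\ T 0 = 0, forall X Y, T (X + Y) = T X + T Y,
  forall f X, T (f *: X) = f * T X & forall X, T (- X) = - T X].
Proof.
move=> sT; have TD X Y : T (X + Y) = T X + T Y.
  by have := sT 1 X Y; rewrite scale1r mul1r.
have T0 : T 0 = 0 by apply: (addIr (T 0)); rewrite -TD !add0r.
have TZ f X : T (f *: X) = f * T X by have := sT f X 0; rewrite !addr0 T0 addr0.
by split=> // X; rewrite -scaleN1r TZ mulN1r.
Qed.

Let linE (T : XM -> XM) : linear T -> [/\ T 0 = 0, forall X Y, T (X + Y) = T X + T Y,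
  forall f X, T (f *: X) = f *: T X & forall X, T (- X) = - T X].
Proof.
move=> sT; have TD X Y : T (X + Y) = T X + T Y.
  by have := sT 1 X Y; rewrite !scale1r.
have T0 : T 0 = 0 by apply: (addIr (T 0)); rewrite -TD !add0r.
have TZ f X : T (f *: X) = f *: T X by have := sT f X 0; rewrite !addr0 T0 addr0.
by split=> // X; rewrite -scaleN1r TZ scaleN1r.
Qed.

Lemma g0l Y : g 0 Y = 0. Proof. by have [] := scalarE (gl Y). Qed.
Lemma gDl X Y Z : g (X + Y) Z = g X Z + g Y Z.
Proof. by have [_ + _ _] := scalarE (gl Z); exact. Qed.
Lemma gZl f X Y : g (f *: X) Y = f * g X Y.
Proof. by have [_ _ + _] := scalarE (gl Y); exact. Qed.
Lemma gNl X Y : g (- X) Y = - g X Y.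
Proof. by have [_ _ _] := scalarE (gl Y); exact. Qed.
Lemma g0r X : g X 0 = 0. Proof. by rewrite gC g0l. Qed.
Lemma gDr X Y Z : g Z (X + Y) = g Z X + g Z Y.
Proof. by rewrite gC gDl !(gC Z). Qed.
Lemma gZr f X Y : g Y (f *: X) = f * g Y X.
Proof. by rewrite gC gZl gC. Qed.
Lemma gNr X Y : g Y (- X) = - g Y X.
Proof. by rewrite gC gNl gC. Qed.

Lemma nab0l Z : nab 0 Z = 0. Proof. by have [] := linE (nabl Z). Qed.
Lemma nabDl X Y Z : nab (X + Y) Z = nab X Z + nab Y Z.
Proof. by have [_ + _ _] := linE (nabl Z); exact. Qed.
Lemma nabZl f X Y : nab (f *: X) Y = f *: nab X Y.
Proof. by have [_ _ + _] := linE (nabl Y); exact. Qed.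
Lemma nabNl X Y : nab (- X) Y = - nab X Y.
Proof. by have [_ _ _] := linE (nabl Y); exact. Qed.
Lemma nab0r X : nab X 0 = 0.
Proof. by apply: (addIr (nab X 0)); rewrite -nabD !add0r. Qed.
Lemma nabNr X Y : nab X (- Y) = - nab X Y.
Proof. by apply: (addIr (nab X Y)); rewrite -nabD !addNr nab0r. Qed.

Lemma phi0 : phi 0 = 0. Proof. by have [] := linE phil. Qed.
Lemma phiD X Y : phi (X + Y) = phi X + phi Y. Proof. by have [] := linE phil. Qed.
Lemma phiZ f X : phi (f *: X) = f *: phi X. Proof. by have [] := linE phil. Qed.
Lemma phiN X : phi (- X) = - phi X. Proof. by have [] := linE phil. Qed.

Lemma etaD X Y : eta (X + Y) = eta X + eta Y. Proof. by have [] := scalarE etal. Qed.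
Lemma etaZ f X : eta (f *: X) = f * eta X. Proof. by have [] := scalarE etal. Qed.
Lemma etaN X : eta (- X) = - eta X. Proof. by have [] := scalarE etal. Qed.
Lemma eta0 : eta 0 = 0. Proof. by have [] := scalarE etal. Qed.

Lemma D0 X : D X 0 = 0.
Proof. by apply: (addIr (D X 0)); rewrite -Dadd !add0r. Qed.
Lemma DN X f : D X (- f) = - D X f.
Proof. by apply: (addIr (D X f)); rewrite -Dadd !addNr D0. Qed.
Lemma D1 X : D X 1 = 0.
Proof.
by apply: (addIr (D X 1)); rewrite add0r -{3}[1](mulr1 1) DM mulr1 mul1r.
Qed.
Lemma DMn X f n : D X (f *+ n) = D X f *+ n.
Proof. by elim: n => [|n IHn]; rewrite ?mulr0n ?D0 // !mulrS Dadd IHn. Qed.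
Lemma DNl X f : D (- X) f = - D X f.
Proof. by rewrite -scaleN1r DZl mulN1r. Qed.

Definition bilinE := (gDl, gZl, gNl, g0l, gDr, gZr, gNr, g0r, nabDl, nabZl, nabNl,
  nab0l, nabD, nabZ, nabNr, nab0r, phiD, phiZ, phiN, phi0, etaD, etaZ, etaN, eta0).
Definition derE := (Dadd, DM, DN, D0, D1, DMn, Daddl, DZl, DNl).

(** Since phi^2 xi = 0, the formula for phi^2 at phi xi gives phi xi = c xi with c = eta (phi xi).
    Applying phi once more yields c^2 = 0, and the ring is reduced. *)
Lemma phi_xi : phi xi = 0.
Proof.
have pp : phi (phi xi) = 0 by rewrite phi_phi eta_xi scale1r addNr.
have px : phi xi = eta (phi xi) *: xi.
  have := phi_phi (phi xi); rewrite pp phi0 addrC => /esym/eqP.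
  by rewrite subr_eq0 => /eqP.
have e0 : eta (phi xi) = 0.
  have E : (eta (phi xi) * eta (phi xi)) *: xi = 0 by rewrite -scalerA -px -phiZ -px pp.
  by apply: reduced; rewrite -[LHS]mulr1 -eta_xi -etaZ E eta0.
by rewrite px e0 scale0r.
Qed.

Lemma g_xi X : g X xi = eta X.
Proof.
have := g_phi_phi X xi; rewrite phi_xi g0r eta_xi mulr1 => /esym/eqP.
by rewrite subr_eq0 => /eqP.
Qed.

Lemma g_xil X : g xi X = eta X. Proof. by rewrite gC g_xi. Qed.

Lemma eta_phi X : eta (phi X) = 0.
Proof.
have E : phi (phi (phi X)) = - phi X.
  by rewrite (phi_phi X) phiD phiN phiZ phi_xi scaler0 addr0.
have := phi_phi (phi X); rewrite E => /eqP; rewrite -subr_eq0 opprD addNKr oppr_eq0.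
by move=> /eqP /(congr1 eta); rewrite etaZ eta_xi mulr1 eta0.
Qed.

Lemma g_phi X Y : g (phi X) Y = - g X (phi Y).
Proof.
have := g_phi_phi X (phi Y); rewrite phi_phi gDr gNr gZr g_xi !eta_phi !mulr0.
by rewrite addr0 subr0 => <-; rewrite opprK.
Qed.

Lemma twice_eq0 f : f + f = 0 -> f = 0.
Proof. by rewrite -mulr2n; exact: torsion_free. Qed.

(** The Kenmotsu equation at Y = xi gives phi (nab X xi) = phi X, and nab X xi is horizontal because
    xi has unit length; apply phi again. *)
Lemma nab_xi X : nab X xi = X - eta X *: xi.
Proof.
have e0 : eta (nab X xi) = 0.
  by apply: twice_eq0; have := Dg X xi xi; rewrite !g_xi g_xil eta_xi D1.
have E : phi (nab X xi) = phi X.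
  have := nab_phi0 X xi; rewrite phi_xi nab0r sub0r g_xi eta_phi eta_xi scale0r scale1r sub0r.
  by move/oppr_inj.
have := phi_phi (nab X xi); rewrite E phi_phi e0 scale0r addr0 => H.
by rewrite -[nab X xi]opprK -H opprD opprK.
Qed.

Lemma eta_nab X Y : eta (nab X Y) = D X (eta Y) - (g X Y - eta X * eta Y).
Proof.
by rewrite -!g_xi Dg nab_xi !bilinE !g_xi (gC Y X); ring.
Qed.

Lemma nab_phi X Y :
  nab X (phi Y) = phi (nab X Y) - g X (phi Y) *: xi - eta Y *: phi X.
Proof.
by rewrite -[LHS](subrK (phi (nab X Y))) nab_phi0 g_phi scaleNr addrC addrA.
Qed.

Definition kenE := (g_phi_phi, g_phi, g_xi, g_xil, eta_phi, eta_xi, phi_xi, nab_xi,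
  nab_phi, eta_nab, phi_phi).

(** * The curvature tensor and the Bianchi identities *)

Definition curv X Y Z := nab X (nab Y Z) - nab Y (nab X Z) - nab (br X Y) Z.

Lemma curvC X Y Z : curv Y X Z = - curv X Y Z.
Proof.
apply: vec_eq => W; rewrite /curv !brE !bilinE; ring.
Qed.

Lemma curv_linear3 X Y : linear (curv X Y).
Proof.
move=> f Z W; apply: vec_eq => U; rewrite /curv !bilinE ?derE ?bilinE Dbr; ring.
Qed.

Lemma curv_linear1 Y Z : linear (fun X => curv X Y Z).
Proof.
move=> f X W; apply: vec_eq => U; rewrite /curv !brE !bilinE ?derE ?bilinE; ring.
Qed.

Lemma curv_skew X Y Z W : g (curv X Y Z) W = - g Z (curv X Y W).
Proof.
have := Dbr X Y (g Z W); rewrite !Dg !Dadd !Dg /curv !bilinE => E.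
apply: (eq_comb (k := -1) E); ring.
Qed.

Lemma bianchi1 X Y Z : curv X Y Z + curv Y Z X + curv Z X Y = 0.
Proof.
have := jacobi X Y Z; rewrite !brE => E.
apply: vec_eq => U; rewrite g0l.
have := congr1 (g^~ U) E; rewrite g0l /curv !brE !bilinE => <-; ring.
Qed.

(** The cyclic sum of (nabla_X R)(Y, Z) W, where torsion-freeness has merged the terms R(nabla_X Y,
    Z) into brackets. After expansion only the Jacobi identity of the bracket is left. *)
Lemma bianchi2 X Y Z W :
  (nab X (curv Y Z W) - curv Y Z (nab X W) - curv (br X Y) Z W) +
  (nab Y (curv Z X W) - curv Z X (nab Y W) - curv (br Y Z) X W) +
  (nab Z (curv X Y W) - curv X Y (nab Z W) - curv (br Z X) Y W) = 0.
Proof.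
have brC A B : br A B = - br B A by rewrite !brE opprB.
apply: vec_eq => U; have := congr1 (fun V => g (nab V W) U) (jacobi X Y Z).
rewrite /curv !bilinE => E; apply: (eq_comb (k := -1) E).
rewrite (brC (br X Y)) (brC (br Y Z)) (brC (br Z X)) !bilinE; ring.
Qed.

(** Squared length of the horizontal part of X; it is the denominator that replaces normalising a
    local frame. *)
Definition nu X := g X X - eta X * eta X.

Lemma g_self_phi X : g X (phi X) = 0.
Proof. by apply: twice_eq0; rewrite {1}gC g_phi addNr. Qed.

Lemma g_phiC X Y : g Y (phi X) = - g X (phi Y).
Proof. by rewrite gC g_phi. Qed.

(** Here z is g(y, y) times the part of x orthogonal to y and phi y. In rank 3 nothing but 0 is
    orthogonal to xi, y and phi y where y is nonzero. *)
Lemma horizontal_orth (x y : XM) : eta x = 0 -> eta y = 0 ->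
  let z := g y y *: x - (g x y *: y + g x (phi y) *: phi y) in
  [/\ g z xi = 0, g z y = 0 & g z (phi y) = 0].
Proof.
move=> ex ey; split; rewrite !bilinE ?kenE ?ex ?ey.
by rewrite ?g0r; ring.
by rewrite g_self_phi; ring.
by rewrite g_self_phi; ring.
Qed.

Lemma span_horizontal :
  (forall x y : XM, eta x = 0 -> eta y = 0 ->
    g y y *: x = g x y *: y + g x (phi y) *: phi y) ->
  forall X Y, nu Y *: (X - eta X *: xi) =
    (g X Y - eta X * eta Y) *: (Y - eta Y *: xi) + g X (phi Y) *: phi Y.
Proof.
move=> H X Y.
have eh Z : eta (Z - eta Z *: xi) = 0 by rewrite !bilinE eta_xi; ring.
have := H _ _ (eh X) (eh Y).
rewrite !(bilinE, kenE) scaler0 !subr0 => E.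
have -> : nu Y = g Y Y - eta Y * eta Y - eta Y * (eta Y - eta Y * 1) by rewrite /nu; ring.
rewrite E; congr (_ *: _ + _ *: _); ring.
Qed.

(* The first field says that the horizontal distribution has rank at most 2, the
   second that it is nowhere trivial, the third that quotients by powers of the
   functions nu e glue to a global function when they agree. *)
Record three_dimensional : Prop := {
  td_span : forall X Y, nu Y *: (X - eta X *: xi) =
    (g X Y - eta X * eta Y) *: (Y - eta Y *: xi) + g X (phi Y) *: phi Y;
  td_ample : forall f, (forall e, nu e * f = 0) -> f = 0;
  td_glue : forall k (a : XM -> C),
    (forall e e', nu e ^+ k * nu e' ^+ k * (nu e ^+ k * a e' - nu e' ^+ k * a e) = 0) ->
    exists c, forall e, nu e ^+ k * (nu e ^+ k * c - a e) = 0 }.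

(** * Horizontal forms and curvature in dimension three *)

Context (H3 : three_dimensional).
Let dim3 := td_span H3.
Let ample := td_ample H3.
Let glue := td_glue H3.

Lemma nilpotent0 k f : f ^+ k.+1 = 0 -> f = 0.
Proof.
have [m] := ubnP k; elim: m k f => // m IHm [|k] f; first by rewrite expr1.
rewrite ltnS => km fk; apply: (IHm k) => //; apply: reduced.
by rewrite -exprD addSn -addnS exprD fk mulr0.
Qed.

(** A power of a * f vanishes and the ring is reduced. Identities may thus be proved up to any power
    of [nu e], which [ample_exp] then removes. *)
Lemma cancel_exp a k f : a ^+ k * f = 0 -> a * f = 0.
Proof.
case: k => [|k] H; first by move: H; rewrite expr0 mul1r => ->; rewrite mulr0.
by apply: (@nilpotent0 k); rewrite exprMn (exprS f) mulrA H mul0r.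
Qed.

Lemma ample_exp k f : (forall e, nu e ^+ k * f = 0) -> f = 0.
Proof. by move=> H; apply: ample => e; exact: cancel_exp (H e). Qed.

Lemma nu_phi X : nu (phi X) = nu X.
Proof. by rewrite /nu !kenE mulr0 subr0. Qed.

(** Expand the horizontal part of X along e and phi e by [dim3]; as [nu (phi e) = nu e], the
    hypothesis covers both directions. *)
Lemma horizontal_1form (th : XM -> C) : scalar th ->
  (forall e, nu e * th (e - eta e *: xi) = 0) -> forall X, th (X - eta X *: xi) = 0.
Proof.
move=> sth H X; have [_ thD thZ thN] := scalarE sth.
apply: (@ample_exp 2) => e.
have E : nu e * th (X - eta X *: xi) =
    (g X e - eta X * eta e) * th (e - eta e *: xi) + g X (phi e) * th (phi e).
  by rewrite -!thZ -thD dim3.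
have H2 : nu e * th (phi e) = 0.
  by have := H (phi e); rewrite nu_phi eta_phi scale0r subr0.
by rewrite expr2 -mulrA E mulrDr !(mulrCA (nu e)) H H2 !mulr0 addr0.
Qed.

Record horizontal_2form (al : XM -> XM -> C) : Prop := {
  h2_linear : forall Y, scalar (al^~ Y);
  h2_skew : forall X Y, al Y X = - al X Y;
  h2_xi : forall Y, al xi Y = 0 }.

Lemma h2_expand al : horizontal_2form al -> forall e X Y,
  nu e ^+ 2 * al X Y = ((g X e - eta X * eta e) * g Y (phi e)
    - g X (phi e) * (g Y e - eta Y * eta e)) * al e (phi e).
Proof.
move=> [all alC alxi] e X Y.
have alE Z := scalarE (all Z).
have alDl Z W U : al (Z + W) U = al Z U + al W U by have [_] := alE U.
have alZl f Z U : al (f *: Z) U = f * al Z U by have [_ _] := alE U.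
have alNl Z U : al (- Z) U = - al Z U by have [_ _ _] := alE U.
have alDr Z W U : al U (Z + W) = al U Z + al U W.
  by rewrite alC alDl opprD -!alC.
have alZr f Z U : al U (f *: Z) = f * al U Z by rewrite alC alZl -mulrN -alC.
have alNr Z U : al U (- Z) = - al U Z by rewrite alC alNl -alC.
have alxir U : al U xi = 0 by rewrite alC alxi oppr0.
have al0 U : al U U = 0 by apply: twice_eq0; rewrite {1}alC addNr.
have -> : nu e ^+ 2 * al X Y = al (nu e *: (X - eta X *: xi)) (nu e *: (Y - eta Y *: xi)).
  rewrite !(alDl, alZl, alNl, alDr, alZr, alNr) !(alxi, alxir); ring.
rewrite !dim3 !(alDl, alZl, alNl, alDr, alZr, alNr) !(alxi, alxir, al0).
by rewrite (alC e (phi e)); ring.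
Qed.

Lemma fundamental_2form : horizontal_2form (fun X Y => g X (phi Y)).
Proof.
split=> [Y|X Y|Y]; first exact: (gl (phi Y)).
  by rewrite gC g_phi.
by rewrite !kenE.
Qed.

(** On a plane all 2-forms are proportional: compare the expansions of al and of the fundamental
    form, whose value on e and phi e is - nu e. *)
Lemma two_form al : horizontal_2form al ->
  forall e X Y, nu e ^+ 2 * (nu e * al X Y + g X (phi Y) * al e (phi e)) = 0.
Proof.
move=> hal e X Y.
have E1 := h2_expand hal e X Y.
have E2 := h2_expand fundamental_2form e X Y.
have Ee : g e (phi (phi e)) = - nu e by rewrite phi_phi !bilinE g_xi /nu; ring.
rewrite Ee in E2.
by rewrite mulrDr mulrCA E1 mulrA E2; ring.
Qed.

(** Deviation from the curvature tensor of constant curvature -1. It vanishes as soon as an argument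
    is xi, hence is a horizontal 2-form in each pair. *)
Definition scurv X Y Z W := g (curv X Y Z) W + g Y Z * g X W - g X Z * g Y W.

Lemma scurv_skew12 X Y Z W : scurv Y X Z W = - scurv X Y Z W.
Proof. by rewrite /scurv curvC !bilinE; ring. Qed.

Lemma scurv_skew34 X Y Z W : scurv X Y W Z = - scurv X Y Z W.
Proof. by rewrite /scurv curv_skew (gC (curv X Y Z) W); ring. Qed.

Lemma curv_xi X Y : curv X Y xi = eta X *: Y - eta Y *: X.
Proof.
apply: vec_eq => W; rewrite /curv brE !(bilinE, kenE, derE).
rewrite (gC Y X); ring.
Qed.

Lemma scurv_xi3 X Y W : scurv X Y xi W = 0.
Proof. by rewrite /scurv curv_xi !(bilinE, kenE); ring. Qed.

(** The first Bianchi identity makes [scurv xi] symmetric in its first two remaining arguments,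
    while it is skew in the last two; such a trilinear form is zero. *)
Lemma scurv_xi1 Y Z W : scurv xi Y Z W = 0.
Proof.
have S Y' Z' W' : scurv xi Y' Z' W' = scurv xi Z' Y' W'.
  have B := congr1 (g^~ W') (bianchi1 xi Y' Z').
  rewrite g0l curv_xi (curvC xi Z' Y') !bilinE in B.
  apply: (eq_comb (k := 1) B); rewrite /scurv /curv !g_xil (gC Z' Y') !bilinE; ring.
apply: twice_eq0.
have E : scurv xi Y Z W = - scurv xi Y Z W.
  by rewrite {1}S scurv_skew34 S scurv_skew34 opprK S scurv_skew34.
by rewrite {1}E addNr.
Qed.

Lemma scurv_h12 Z W : horizontal_2form (fun X Y => scurv X Y Z W).
Proof.
split=> [Y f X X'|X Y|Y]; last exact: scurv_xi1; last exact: scurv_skew12.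
by rewrite /scurv (curv_linear1 Y Z) !bilinE; ring.
Qed.

Lemma scurv_h34 X Y : horizontal_2form (scurv X Y).
Proof.
split=> [W f Z Z'|Z W|W]; last exact: scurv_xi3; last exact: scurv_skew34.
by rewrite /scurv (curv_linear3 X Y) !bilinE; ring.
Qed.

(** Applying [two_form] to each pair of arguments leaves the single function a e / nu e ^ 2. The
    identity [key] at e' and phi e' says that these quotients agree for different e, so they glue to
    mu. *)
Lemma curvature_form : exists mu, forall X Y Z,
  curv X Y Z = g X Z *: Y - g Y Z *: X + (mu * g X (phi Y)) *: phi Z.
Proof.
pose a e := - scurv e (phi e) e (phi e).
have key e X Y Z W : nu e ^+ 2 *
    (nu e ^+ 2 * scurv X Y Z W + g X (phi Y) * g Z (phi W) * a e) = 0.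
  have A := two_form (scurv_h12 Z W) e X Y.
  have B := two_form (scurv_h34 e (phi e)) e Z W.
  transitivity (nu e * 0 - g X (phi Y) * 0 : C); last by rewrite !mulr0 subrr.
  by rewrite -{1}A -B /a; ring.
have [mu muE] : exists c, forall e, nu e ^+ 2 * (nu e ^+ 2 * c - a e) = 0.
  apply: glue => e e'; have := key e e' (phi e') e' (phi e').
  have -> : g e' (phi (phi e')) = - nu e' by rewrite phi_phi !bilinE g_xi /nu; ring.
  move=> H; transitivity (- nu e' ^+ 2 * 0 : C); last by rewrite mulr0.
  by rewrite -H /a; ring.
exists mu => X Y Z; apply: vec_eq => W.
have E : scurv X Y Z W + mu * (g X (phi Y) * g Z (phi W)) = 0.
  apply: (@ample_exp 4) => e.
  transitivity (0 + (g X (phi Y) * g Z (phi W)) * 0 : C); last by rewrite mulr0 addr0.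
  by rewrite -{1}(key e X Y Z W) -(muE e); ring.
apply: (eq_comb (k := 1) E); rewrite /scurv !(bilinE, kenE); ring.
Qed.

(** * Consequences of the soliton equation *)

Section Soliton.
Context (mu : C) (curvE : forall X Y Z,
  curv X Y Z = g X Z *: Y - g Y Z *: X + (mu * g X (phi Y)) *: phi Z).

(** Second Bianchi identity on xi, e, phi e, evaluated on e and paired with phi e. *)
Lemma D_xi_mu : D xi mu = - (mu *+ 2).
Proof.
suff H : D xi mu + mu *+ 2 = 0 by apply: (eq_comb (k := 1) H); ring.
apply: (@ample_exp 2) => e.
have := congr1 (g^~ (phi e)) (bianchi2 xi e (phi e) e).
rewrite /= g0l !curvE !brE !(bilinE, kenE, derE) !Dg !(bilinE, kenE, derE).
rewrite !g_self_phi !(gC e (nab _ _)) => E.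
by apply: (eq_comb (k := -1) E); rewrite /nu; ring.
Qed.

(** In [sol] the tensor S^* is already replaced by its value from [star_ricci_eq]. *)
Context (V : XM) (l : C) (Dl : forall X, D X l = 0)
  (sol : forall X Y, D V (g X Y) - g (br V X) Y - g X (br V Y)
     + (mu - 1) * (g X Y - eta X * eta Y) *+ 2 + l * g X Y *+ 2 = 0).
(* When l = 0, G is the gradient of eta V. *)
Context (b G : XM) (bE : b = nab xi V + l *: xi) (GE : G = V - eta V *: xi - b).

Lemma nabV_sym X Y : g (nab X V) Y + g X (nab Y V) =
  ((1 - mu) * (g X Y - eta X * eta Y) - l * g X Y) *+ 2.
Proof.
by have := sol X Y; rewrite !brE Dg !bilinE => E; apply: (eq_comb (k := 1) E); ring.
Qed.

Lemma D_xi_etaV : D xi (eta V) = - l.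
Proof.
have := nabV_sym xi xi; rewrite g_xil !g_xi eta_nab g_xil eta_xi => E.
apply/subr0_eq/twice_eq0; apply: (eq_comb (k := 1) E); ring.
Qed.

Lemma g_nab_xi_V X : g (nab xi V) X = g V X - eta V * eta X - D X (eta V) - l * eta X *+ 2.
Proof.
have := nabV_sym X xi; rewrite !g_xi eta_nab eta_xi (gC X (nab _ _)) (gC X V) => E.
apply: (eq_comb (k := 1) E); ring.
Qed.

Lemma g_b X : g b X = g V X - eta V * eta X - D X (eta V) - l * eta X.
Proof. by rewrite bE !bilinE g_nab_xi_V g_xil; ring. Qed.

Lemma g_G X : g G X = D X (eta V) + l * eta X.
Proof. by rewrite GE !bilinE g_b g_xil; ring. Qed.

Lemma eta_b : eta b = 0.
Proof. by rewrite -g_xi g_b g_xi eta_xi D_xi_etaV; ring. Qed.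

Lemma eta_G : eta G = 0.
Proof. by rewrite -g_xi g_G eta_xi D_xi_etaV; ring. Qed.

(** The soliton equation fixes the symmetric part of nabla V, and b accounts for the xi-components.
    What is left is a horizontal 2-form, whose ratio to the fundamental form gives the rotation
    [om]. *)
Lemma nabV_skew_form : horizontal_2form (fun X Y => g (nab X V) Y + (mu - 1 + l) * g X Y
  - (mu - 1) * eta X * eta Y - eta X * g b Y + g b X * eta Y).
Proof.
split=> [Y f X X'|X Y|Y].
- by rewrite !bilinE; ring.
- have := nabV_sym X Y; rewrite (gC X (nab _ _)) => E.
  by apply: (eq_comb (k := 1) E); rewrite (gC Y X); ring.
- by rewrite bE !bilinE !g_xil !g_xi eta_nab g_xil eta_xi D_xi_etaV; ring.
Qed.

Lemma nabV_rotation : exists om, forall X, nab X V = (1 - mu - l) *: X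
  - ((1 - mu) * eta X) *: xi + om *: phi X + eta X *: b - g b X *: xi.
Proof.
pose be X Y := g (nab X V) Y + (mu - 1 + l) * g X Y
  - (mu - 1) * eta X * eta Y - eta X * g b Y + g b X * eta Y.
have be2 : horizontal_2form be by exact: nabV_skew_form.
have key := two_form be2.
have [om omE] : exists c, forall e, nu e ^+ 1 * (nu e ^+ 1 * c - be e (phi e)) = 0.
  apply: glue => e e'; have := key e e' (phi e').
  have -> : g e' (phi (phi e')) = - nu e' by rewrite phi_phi !bilinE g_xi /nu; ring.
  rewrite mulNr => /cancel_exp H.
  by rewrite !expr1 mulrAC H mul0r.
exists om => X; apply: vec_eq => Y.
have E : be X Y + om * g X (phi Y) = 0.
  apply: (@ample_exp 3) => e.
  transitivity (0 + nu e * g X (phi Y) * 0 : C); last by rewrite mulr0 addr0.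
  by rewrite -{1}(key e X Y) -(omE e); ring.
by apply: (eq_comb (k := 1) E); rewrite /be !bilinE g_phi !g_xil; ring.
Qed.

Section Rotation.
Context (om : C) (nabV : forall X, nab X V = (1 - mu - l) *: X
  - ((1 - mu) * eta X) *: xi + om *: phi X + eta X *: b - g b X *: xi).

Lemma curvV X Y : nab X (nab Y V) - nab Y (nab X V) - nab (br X Y) V =
  g X V *: Y - g Y V *: X + (mu * g X (phi Y)) *: phi V.
Proof. by rewrite -curvE. Qed.

(** Ricci identity of V on xi and Y. The derivatives of b remaining on the right are eliminated in
    [nabG_rotation] through the symmetry of nabla G. *)
Lemma nab_b Y : nab Y b = - D xi mu *: (Y - eta Y *: xi) + (1 - mu) *: (Y - eta Y *: xi)
  + (D xi om + om) *: phi Y + eta Y *: nab xi b - eta V *: Y + g V Y *: xi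
  + (g (nab Y b) xi - g (nab xi b) Y) *: xi.
Proof.
apply: vec_eq => U; have := congr1 (g^~ U) (curvV xi Y).
rewrite /= brE !nabV ?(bilinE, kenE, derE) ?Dl ?Dg ?(bilinE, kenE, derE, nabV).
rewrite !eta_b !D0 (gC Y V) (gC Y b) => E.
by apply: (eq_comb (k := -1) E); ring.
Qed.

(** G is dual to d (eta V) + l eta, which is closed because eta is. *)
Lemma nabG_sym Y Z : g (nab Y G) Z = g (nab Z G) Y.
Proof.
have E A B : g (nab A G) B = D A (D B (eta V)) + l * D A (eta B)
    - D (nab A B) (eta V) - l * eta (nab A B).
  have := Dg A G B; rewrite !g_G ?derE Dl => H; apply: (eq_comb (k := -1) H); ring.
have := Dbr Y Z (eta V); rewrite brE !derE => H.
rewrite !E !eta_nab; apply: (eq_comb (k := -1) H); rewrite (gC Z Y); ring.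
Qed.

Lemma nabG_xi Y : g (nab Y G) xi = - g G Y.
Proof. by rewrite g_xi eta_nab eta_G D0 (gC Y G); ring. Qed.

Lemma nabG_rotation Y : nab Y G = (D xi mu - l) *: (Y - eta Y *: xi)
  - D xi om *: phi Y - eta Y *: G - g G Y *: xi.
Proof.
have ngxi U : g (nab xi G) U = - g G U by rewrite nabG_sym nabG_xi.
have bG : b = V - eta V *: xi - G by rewrite GE opprB addrC subrK.
have nb A U : g (nab A b) U = g (nab A V) U - D A (eta V) * eta U
    - eta V * (g A U - eta A * eta U) - g (nab A G) U.
  by rewrite {1}bG !bilinE nab_xi !bilinE !g_xil; ring.
apply: vec_eq => U; have := nb Y U; rewrite {1}nab_b !bilinE => H.
apply: (eq_comb (k := 1) H).
rewrite !nb !nabV !bilinE !ngxi !nabG_xi !kenE eta_b !g_b !g_G D_xi_etaV.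
rewrite g0r g0l; ring.
Qed.

(** The only skew term of nabla G in [nabG_rotation] is the one with phi, and nabla G is
    symmetric. *)
Lemma D_xi_om : D xi om = 0.
Proof.
apply: ample => e; apply: twice_eq0.
have := nabG_sym e (phi e); rewrite !nabG_rotation !(bilinE, kenE) g_self_phi => H.
by apply: (eq_comb (k := -1) H); rewrite /nu; ring.
Qed.

Lemma nabG Y : nab Y G = - (mu *+ 2 + l) *: (Y - eta Y *: xi)
  - eta Y *: G - g G Y *: xi.
Proof. by rewrite nabG_rotation D_xi_om scale0r subr0 D_xi_mu -opprD. Qed.

Lemma curvG X Y : nab X (nab Y G) - nab Y (nab X G) - nab (br X Y) G =
  g X G *: Y - g Y G *: X + (mu * g X (phi Y)) *: phi G.
Proof. by rewrite -curvE. Qed.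

(** Ricci identity of G on xi and e, paired with e, with xi mu = -2 mu. *)
Lemma soliton_steady : l = 0.
Proof.
apply: twice_eq0; apply: ample => e.
have := congr1 (g^~ e) (curvG xi e).
rewrite /= brE !nabG ?(bilinE, kenE, derE) ?Dl ?Dg ?(bilinE, kenE, derE, nabG).
rewrite D_xi_mu !eta_G D0 (gC e G) => H.
by apply: (eq_comb (k := -1) H); rewrite /nu; ring.
Qed.

Lemma D_etaV X : D X (eta V) = g G X.
Proof. by rewrite g_G soliton_steady mul0r addr0. Qed.

(** The xi-component is [D_xi_mu]; the horizontal one is the Ricci identity of G on phi e and e,
    paired with phi e. *)
Lemma D_mu X : D X mu *+ 2 = mu * g G X - mu * eta X *+ 4.
Proof.
pose th X := D X mu *+ 2 - mu * g G X + mu * eta X *+ 4.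
have sth : scalar th.
  by move=> a Y Z; rewrite /th !(derE, bilinE); ring.
have thxi : th xi = 0 by rewrite /th D_xi_mu g_xi eta_G eta_xi; ring.
suff H : forall Y, th (Y - eta Y *: xi) = 0.
  have [_ thD thZ thN] := scalarE sth.
  have := H X; rewrite thD thN thZ thxi mulr0 oppr0 addr0 => E.
  by apply: (eq_comb (k := 1) E); rewrite /th; ring.
apply: horizontal_1form => // e.
have := congr1 (g^~ (phi e)) (curvG (phi e) e).
rewrite /= brE !nabG ?(bilinE, kenE, derE) ?Dl ?Dg ?(bilinE, kenE, derE, nabG).
rewrite ?g_self_phi ?eta_G ?D0 ?(gC e G) ?(gC (phi e) G) => E.
rewrite /th !(derE, bilinE, kenE) D_xi_mu eta_G.
by apply: (eq_comb (k := 1) E); rewrite soliton_steady /nu; ring.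
Qed.

(** Ricci identity of V on a horizontal h and phi h, paired with h; [D_mu] then removes the
    derivative of mu along phi h. *)
Lemma D_om X : D X om *+ 2 = (mu + 2%:R) * g G (phi X) - mu * g V (phi X) *+ 2.
Proof.
pose th X := D X om *+ 2 - ((mu + 2%:R) * g G (phi X) - mu * g V (phi X) *+ 2).
have sth : scalar th.
  by move=> a Y Z; rewrite /th !(derE, bilinE); ring.
have thxi : th xi = 0 by rewrite /th D_xi_om phi_xi !g0r; ring.
suff H : forall Y, th (Y - eta Y *: xi) = 0.
  have [_ thD thZ thN] := scalarE sth.
  have := H X; rewrite thD thN thZ thxi mulr0 oppr0 addr0 => E.
  by apply: (eq_comb (k := 1) E); rewrite /th; ring.
apply: horizontal_1form => // e.
have hE : nu e = g (e - eta e *: xi) (e - eta e *: xi).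
  by rewrite /nu !bilinE !g_xi !g_xil eta_xi; ring.
have : eta (e - eta e *: xi) = 0 by rewrite !bilinE eta_xi; ring.
rewrite hE; move: (e - eta e *: xi) => h eta_h.
have := congr1 (g^~ h) (curvV h (phi h)).
rewrite /= brE !nabV ?(bilinE, kenE, derE) ?Dl ?Dg ?(bilinE, kenE, derE, nabV).
rewrite ?g_self_phi ?eta_h ?D0 ?(g_phiC V h) !g_b ?eta_phi !D_etaV => E.
have Dm := D_mu (phi h); rewrite eta_phi in Dm.
apply: (eq_comb2 (k := -2%:R) E (m := g h h) Dm).
rewrite /th (gC h V) soliton_steady; ring.
Qed.

(** Parseval's identity in the orthogonal pair h, phi h, both of squared length g(h, h). *)
Lemma g_horizontal_frame X Y (h : XM) : eta X = 0 -> eta h = 0 ->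
  g h h * g X Y = g X h * g Y h + g X (phi h) * g Y (phi h).
Proof.
move=> eX eh; have := congr1 (g^~ Y) (dim3 X h).
rewrite /= /nu !bilinE eX eh (gC h Y) (gC (phi h) Y) => E.
apply: (eq_comb (k := 1) E); ring.
Qed.

(* The condition d (d om) = 0, evaluated on a horizontal h and phi h. *)
Lemma D_V_etaV : mu * (D V (eta V) *+ 2 - g G G + 24%:R - eta V *+ 8) = 0.
Proof.
apply: ample => e.
have -> : nu e = g (e - eta e *: xi) (e - eta e *: xi).
  by rewrite /nu !bilinE !g_xi !g_xil eta_xi; ring.
have : eta (e - eta e *: xi) = 0 by rewrite !bilinE eta_xi; ring.
move: (e - eta e *: xi) => h eta_h.
have E : D (br h (phi h)) om *+ 2 = D h (D (phi h) om *+ 2) - D (phi h) (D h om *+ 2).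
  by rewrite Dbr !DMn mulrnBl.
move: E; rewrite !D_om brE phi_phi eta_h ?(bilinE, kenE, derE) ?Dg ?(bilinE, kenE, derE).
rewrite !nabG !nabV ?(bilinE, kenE, derE) ?eta_h ?g_self_phi ?eta_G ?D0.
rewrite ?(g_phiC G h) ?(g_phiC V h) soliton_steady => E.
(* [D_mu] removes the derivatives of mu, and Parseval's identity recovers g(G, G) and g(G, V) from
   the components along h and phi h. *)
have Dh := D_mu h; have Dp := D_mu (phi h); rewrite eta_h in Dh; rewrite eta_phi in Dp.
have NG := g_horizontal_frame G eta_G eta_h.
have NV := g_horizontal_frame V eta_G eta_h.
apply: (eq_comb2 (k := -2%:R) E (m := g G h - g V h *+ 2) Dh).
apply: (eq_comb2 (k := g G (phi h) - g V (phi h) *+ 2) Dp (m := - mu) NG).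
apply: (eq_comb (k := mu *+ 2) NV).
rewrite D_etaV; ring.
Qed.

Lemma mu_D X f : mu * f = 0 -> mu * D X f = 0.
Proof.
move=> f0; apply: twice_eq0; have := congr1 (D X) f0; rewrite DM D0 => E.
have Dm := D_mu X.
apply: (eq_comb2 (k := 2%:R) E (m := - f) Dm).
by apply: (eq_comb (k := eta X *+ 4 - g G X) f0); ring.
Qed.

(* Each equation is mu * F = 0 for a function F, differentiated along G. *)
Lemma soliton_mu_eq0 : mu = 0.
Proof.
have A0 := D_V_etaV; have muD := mu_D.
have DN_ X : D X (g G G) = - (mu * g G X *+ 4) - eta X * g G G *+ 2.
  by rewrite Dg (gC G (nab X G)) nabG soliton_steady !bilinE !g_xil eta_G (gC X G); ring.
have Gf : D G (eta V) = g G G by rewrite D_etaV.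
have GN := DN_ G; rewrite eta_G in GN.
have Gm := D_mu G; rewrite eta_G in Gm.
have Gu : D G (D V (eta V)) *+ 2 = D V (g G G) + (1 - mu) * g G G *+ 2.
  have := Dbr G V (eta V); rewrite !D_etaV brE !bilinE (gC G (nab G V)) nabV soliton_steady.
  rewrite !bilinE eta_G g_xil eta_G (gC (phi G) G) g_self_phi.
  have := Dg V G G; rewrite (gC G (nab V G)) => E1 E2.
  apply: (eq_comb2 (k := 1) E1 (m := -2%:R) E2); ring.
have VN := DN_ V; rewrite -(D_etaV V) in VN.
have A1 : mu * (D V (g G G) + (1 - mu) * g G G *+ 2 + mu * g G G *+ 4 - g G G *+ 8) = 0.
  have H := muD G _ A0; rewrite !derE ?mul0rn GN Gf in H.
  by apply: (eq_comb2 (k := 1) H (m := - mu) Gu); ring.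
set f := eta V in A0 A1 Gf VN *; set N := g G G in A0 A1 Gf GN Gm VN *.
(* V f is eliminated between A1 and A0, using V N = - 4 mu V f - 2 f N. *)
have B0 : mu * (mu *+ 24 - mu * f *+ 8 - f * N - N *+ 3) = 0.
  apply: twice_eq0.
  apply: (eq_comb2 (k := 1) A1 (m := mu *+ 2) A0).
  apply: (eq_comb (k := - mu) VN); ring.
have C0 : mu * (mu * N *+ 16 - N * N) = 0.
  apply: twice_eq0.
  have H := muD G _ B0; rewrite !derE GN Gf in H.
  by apply: (eq_comb2 (k := 2%:R) H (m := - mu * (24%:R - f *+ 8)) Gm); ring.
have muN : mu * N = 0.
  (* C0 and its derivative along G combine to 384 (mu N)^3 = 0; [torsion_free k] divides by k+1. *)
  apply: (@nilpotent0 2); apply: (@torsion_free 383).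
  have H := muD G _ C0; rewrite !derE GN in H.
  apply: (eq_comb2 (k := mu * N ^+ 2 *+ 32) C0 (m := N ^+ 2 *+ 2) H).
  by apply: (eq_comb (k := - (mu * N ^+ 3 *+ 16)) Gm); ring.
have f3 : mu * (3%:R - f) = 0.
  (* With mu N = 0, B0 reduces to 8 mu^2 (3 - f) = 0, which is multiplied by 3 - f to form a
     square. *)
  apply: reduced; apply: (@torsion_free 7).
  by apply: (eq_comb2 (k := 3%:R - f) B0 (m := (3%:R - f) * (f + 3%:R)) muN); ring.
have gG X : mu * g G X = 0.
  by have := muD X _ f3; rewrite !derE ?mul0rn D_etaV => H; apply: (eq_comb (k := -1) H); ring.
(* Differentiating mu g(G, e) = 0 along e brings in the Hessian - 2 mu nu e, hence 2 mu^2 nu e =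
   0. *)
apply: reduced; apply: twice_eq0; apply: ample => e.
have := muD e _ (gG e); rewrite Dg nabG soliton_steady !bilinE !g_xil => H.
apply: (eq_comb2 (k := -1) H (m := 1) (gG (nab e e))).
by apply: (eq_comb (k := - eta e *+ 2) (gG e)); rewrite /nu; ring.
Qed.

End Rotation.

Lemma soliton_flat : mu = 0.
Proof. by have [om nabV] := nabV_rotation; exact: soliton_mu_eq0 nabV. Qed.

End Soliton.

Lemma star_soliton_curvature mu V l :
  (forall X Y Z, curv X Y Z = g X Z *: Y - g Y Z *: X + (mu * g X (phi Y)) *: phi Z) ->
  (forall X, D X l = 0) ->
  (forall X Y, D V (g X Y) - g (br V X) Y - g X (br V Y)
     + (mu - 1) * (g X Y - eta X * eta Y) *+ 2 + l * g X Y *+ 2 = 0) ->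
  mu = 0.
Proof. by move=> curvE Dl sol; exact: (soliton_flat curvE Dl sol erefl erefl). Qed.

End KenmotsuAlgebra.

(** * Kenmotsu manifolds *)

Section KenmotsuManifold.
Context {R : realType} {n : nat} {M : manifold R n}.
Context {phi : vfield M -> vfield M} {xi : vfield M} {eta : vfield M -> smooth_fun M}
  {g : vfield M -> vfield M -> smooth_fun M} {nabla : vfield M -> vfield M -> vfield M}.
Hypothesis HKen : kenmotsu phi xi eta g nabla.

Definition act (X : vfield M) (f : smooth_fun M) : smooth_fun M := X f.

Lemma smooth_fun_mulrn (f : smooth_fun M) k p : (f *+ k) p = f p *+ k.
Proof. by elim: k => // k IHk; rewrite !mulrS sfD IHk. Qed.

Lemma bracketE (X Y : vfield M) f :
  bracket X Y f = (X (Y f) : smooth_fun M) - (Y (X f) : smooth_fun M) :> smooth_fun M.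
Proof. by []. Qed.

Lemma metric_nondeg X : g X X = 0 -> X = 0.
Proof.
move=> gX; apply: at_point_eq0 => p; apply/eqP; apply/negPn/negP => /eqP Xp.
have := metric_pos (acm_metric (kenmotsu_acm HKen)) Xp.
by rewrite gX sf0 ltxx.
Qed.

Lemma kenmotsu_manifold_algebra :
  kenmotsu_algebra act (@bracket R n M) g nabla phi xi eta.
Proof.
have [[phil etal [gl gC gpos] phi_phi eta_xi g_phi_phi] [nabl nabD nabZ tf nabg] ken] := HKen.
split=> //.
- exact: vfieldD.
- exact: vfieldM.
- move=> X Y Z; apply: vfield_eq => f p.
  apply: (congr1 (fun h : smooth_fun M => h p)).
  by rewrite !vfDE !bracketE !(vfieldD, vfieldN) vf0E; ring.
- move=> f ff; apply: smooth_funE => p; have := congr1 (fun h : smooth_fun M => h p) ff.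
  by rewrite sfM => /eqP; rewrite mulf_eq0 orbb => /eqP.
- move=> k f fk; apply: smooth_funE => p; have := congr1 (fun h : smooth_fun M => h p) fk.
  by rewrite smooth_fun_mulrn => /eqP; rewrite mulrn_eq0 /= => /eqP.
- by move=> X gX; apply: metric_nondeg; exact: gX.
Qed.


Lemma metric_scalar Y : scalar (g^~ Y).
Proof. exact: metric_linear (acm_metric (kenmotsu_acm HKen)) Y. Qed.

Lemma metric_at_point0 p X : g X X p = 0 -> at_point p X = 0.
Proof.
move=> gX; apply/eqP; apply/negPn/negP => /eqP Xp.
have := metric_pos (acm_metric (kenmotsu_acm HKen)) Xp.
by rewrite gX ltxx.
Qed.

End KenmotsuManifold.

(** * Three-dimensional Kenmotsu manifolds *)

Section KenmotsuThreeManifold.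
Context {R : realType} {M : manifold R 3}.
Context {phi : vfield M -> vfield M} {xi : vfield M} {eta : vfield M -> smooth_fun M}
  {g : vfield M -> vfield M -> smooth_fun M} {nabla : vfield M -> vfield M -> vfield M}.
Hypothesis HKen : kenmotsu phi xi eta g nabla.
Let HK := kenmotsu_manifold_algebra HKen.

Let gC := ka_gC HK.

(** Where y vanishes both sides do. Elsewhere xi, y, phi y and the difference z of the two sides are
    four mutually orthogonal vectors in a 3-dimensional space, the first three nonzero, so z = 0. *)
Lemma horizontal_plane (x y : vfield M) : eta x = 0 -> eta y = 0 ->
  g y y *: x = g x y *: y + g x (phi y) *: phi y.
Proof.
move=> ex ey; apply/subr0_eq/at_point_eq0 => p.
have [zx zy zp] := horizontal_orth HK ex ey.
have yx : g y xi = 0 by rewrite (g_xi HK).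
have px : g (phi y) xi = 0 by rewrite (g_xi HK) (eta_phi HK).
have yp : g y (phi y) = 0 := g_self_phi HK y.
have pp : g (phi y) (phi y) = g y y by rewrite (ka_g_phi_phi HK) ey mulr0 subr0.
have xx : g xi xi = 1 by rewrite (g_xi HK) (ka_eta_xi HK).
have [y0|y0] := eqVneq (g y y p) 0.
  have Y0 : at_point p y = 0 by exact: (metric_at_point0 HKen).
  have P0 : at_point p (phi y) = 0 by apply: (metric_at_point0 HKen); rewrite pp.
  by rewrite at_pointD at_pointN at_pointD !at_pointZ Y0 P0 y0 scale0r !scaler0 addr0 subr0.
move: (_ - _) zx zy zp => z zx zy zp; apply: (metric_at_point0 HKen).
have [v v0 [i vi]] := at_point_dependent p (fun i : 'I_4 => nth 0 [:: xi; y; phi y; z] i).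
have Hv W : v ord0 * g xi W p + (v (inord 1) * g y W p + (v (inord 2) * g (phi y) W p
    + v (inord 3) * g z W p)) = 0.
  have v0' : at_point p 0 = \sum_i v i *: at_point p (nth 0 [:: xi; y; phi y; z] i).
    by rewrite v0.
  have := at_point_tensorial_lin (metric_scalar HKen W) v0'.
  rewrite (g0l HK) sf0 !big_ord_recl big_ord0 addr0 /= => ->.
  have -> : inord 1 = lift ord0 ord0 :> 'I_4 by apply/val_inj; rewrite /= inordK.
  have -> : inord 2 = lift ord0 (lift ord0 ord0) :> 'I_4.
    by apply/val_inj; rewrite /= inordK.
  have -> : inord 3 = lift ord0 (lift ord0 (lift ord0 ord0)) :> 'I_4.
    by apply/val_inj; rewrite /= inordK.
  by [].
have vx : v ord0 = 0.
  by have := Hv xi; rewrite xx yx px zx !sf0 sf1 !mulr0 !addr0 mulr1.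
have vy : v (inord 1) = 0.
  have := Hv y; rewrite vx mul0r add0r (gC (phi y)) yp zy !sf0 !mulr0 !addr0.
  by move=> /eqP; rewrite mulf_eq0 (negbTE y0) orbF => /eqP.
have vp : v (inord 2) = 0.
  have := Hv (phi y); rewrite vx vy !mul0r !add0r pp zp sf0 mulr0 addr0.
  by move=> /eqP; rewrite mulf_eq0 (negbTE y0) orbF => /eqP.
have := Hv z; rewrite vx vy vp !mul0r !add0r => /eqP.
rewrite mulf_eq0 => /orP[/eqP vz|/eqP //]; case/eqP: vi.
have : i \in [:: ord0; inord 1; inord 2; inord 3].
  by case: i => -[|[|[|[|]]]] //= lt; rewrite !inE -!val_eqE /= ?inordK.
by rewrite !inE => /or4P[] /eqP->.
Qed.

(** Otherwise every vector field would be a multiple of xi at p, contradicting the independence of a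
    frame. *)
Lemma nu_neq0 p : exists e, nu g eta e p != 0.
Proof.
apply: contrapT => /forallNP H.
have H0 e : at_point p e = eta e p *: at_point p xi.
  have : at_point p (e - eta e *: xi) = 0.
    apply: (metric_at_point0 HKen).
    have -> : g (e - eta e *: xi) (e - eta e *: xi) = nu g eta e.
      by rewrite /nu !(gDl HK) !(gNl HK) !(gDr HK) !(gNr HK) !(gZl HK) !(gZr HK)
        !(g_xi HK) !(g_xil HK) (ka_eta_xi HK); ring.
    by apply/eqP; apply/negPn/negP; exact: H.
  by rewrite at_pointD at_pointN at_pointZ => /subr0_eq.
have [E [_ [_ [_ _ [Efree _]]]]] := local_frame p.
(* The relation eta(E_1) E_0 - eta(E_0) E_1 = 0 between two multiples of xi; it forces eta(E_0) = 0,
   and then E_0 = 0 at p. *)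
pose a (i : 'I_3) : R := if i == ord0 then eta (E (inord 1)) p
  else if i == inord 1 then - eta (E ord0) p else 0.
have i01 : (inord 1 == ord0 :> 'I_3) = false by rewrite -val_eqE /= inordK.
have i10 : (ord0 == inord 1 :> 'I_3) = false by rewrite eq_sym.
have a0 : forall i, a i = 0.
  apply: Efree; rewrite (bigD1 ord0) //= (bigD1 (inord 1)) ?i01 //=.
  rewrite big1 => [|i /andP[/negbTE i0 /negbTE i1]].
    rewrite /a eqxx i01 eqxx addr0 (H0 (E ord0)) (H0 (E (inord 1))) !scalerA.
    by rewrite -scalerDl mulNr mulrC addrN scale0r.
  by rewrite /a i0 i1 scale0r.
have e0 : eta (E ord0) p = 0.
  by have /eqP := a0 (inord 1); rewrite /a i01 eqxx oppr_eq0 => /eqP.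
have := Efree (fun i => (i == ord0)%:R) _ ord0.
rewrite eqxx => /(_ _)/eqP; rewrite oner_eq0 => /(_ _)/negP; apply => //.
rewrite (bigD1 ord0) //= big1 ?addr0 => [|i /negbTE->]; last by rewrite scale0r.
by rewrite H0 e0 scale0r scaler0.
Qed.

Lemma smooth_fun_exp (f : smooth_fun M) k p : (f ^+ k) p = f p ^+ k.
Proof. by elim: k => // k IHk; rewrite !exprS sfM IHk. Qed.

Lemma kenmotsu_three_dimensional : three_dimensional g phi xi eta.
Proof.
split.
- exact: (span_horizontal HK horizontal_plane).
- move=> f H; apply: smooth_funE => p; have [e ep] := nu_neq0 p.
  have := congr1 (fun h : smooth_fun M => h p) (H e).
  by rewrite sfM => /eqP; rewrite mulf_eq0 (negbTE ep) => /eqP.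
- move=> k a H; apply: (glue_quotients _ H) => p; have [e ep] := nu_neq0 p.
  by exists e; rewrite smooth_fun_exp expf_neq0.
Qed.

(** The operator is h times the identity plus three rank-one terms. With q = g(X, Y) - eta X eta Y
    and h = mu q its trace is 3 h - 2 q - h, and half of it is (mu - 1) q. *)
Lemma star_ricci_eq mu X Y p :
  (forall X Y Z, curvature nabla X Y Z =
     g X Z *: Y - g Y Z *: X + (mu * g X (phi Y)) *: phi Z) ->
  star_ricci nabla phi X Y p = (mu p - 1) * (g X Y p - eta X p * eta Y p).
Proof.
move=> curvE.
pose h := mu * (g X Y - eta X * eta Y).
pose al (k : 'I_3) : vfield M -> smooth_fun M :=
  nth (fun=> 0) [:: fun Z => g X (phi Z); fun Z => - g (phi Y) (phi Z);
                    fun Z => - h * eta Z] k.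
pose W (k : 'I_3) := nth 0 [:: phi Y; X; xi] k.
have sal k : scalar (al k).
  rewrite /al; case: k => -[|[|[|]]] //= _ a Z Z'.
  - by rewrite !(phiD HK) !(phiZ HK) !(gDr HK) !(gZr HK).
  - by rewrite !(phiD HK) !(phiZ HK) !(gDr HK) !(gZr HK); ring.
  - by rewrite !(etaD HK) !(etaZ HK); ring.
have AE Z : curvature nabla X (phi Y) (phi Z) = h *: Z + \sum_k al k Z *: W k.
  rewrite curvE !big_ord_recl big_ord0 /= addr0 /al /W /=.
  apply: (vec_eq HK) => U.
  rewrite !(ka_phi_phi HK).
  rewrite !(gDl HK, gNl HK, gZl HK, gDr HK, gNr HK, gZr HK, g_xi HK, g_xil HK) /h; ring.
rewrite /star_ricci (trace_rank p sal AE).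
have -> : \sum_k al k (W k) p = g X (phi (phi Y)) p
    + ((- g (phi Y) (phi X)) p + (- h * eta xi) p).
  by rewrite !big_ord_recl big_ord0 addr0.
rewrite !(ka_phi_phi HK) !(gDr HK, gNr HK, gZr HK, g_xi HK) (ka_eta_xi HK) (ka_g_phi_phi HK).
by rewrite (gC Y X) /h !sfE; field.
Qed.

Lemma curvature_flat_sectional :
  (forall X Y Z, curvature nabla X Y Z = g X Z *: Y - g Y Z *: X) ->
  constant_sectional_curvature g nabla (-1).
Proof.
move=> curvE p X Y indep; rewrite /sectional_curvature curvE.
rewrite (gDl HK) (gNl HK) !(gZl HK) (gC Y X) !sfE.
set d := _ - _ ^+ 2.
suff d0 : d != 0.
  have -> : g X Y p * g X Y p + - (g Y Y p * g X X p) = - d by rewrite /d; ring.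
  by rewrite mulNr divff.
apply/negP => /eqP d0.
(* Equality case of Cauchy-Schwarz: the vector a X + b Y has squared length g(Y, Y) d. *)
pose a := g Y Y p; pose b := - g X Y p.
have Z0 : at_point p (const_fun M a *: X + const_fun M b *: Y) = 0.
  apply: (metric_at_point0 HKen).
  rewrite !(gDl HK, gZl HK, gDr HK, gZr HK) (gC Y X) !sfE.
  transitivity (g Y Y p * d); last by rewrite d0 mulr0.
  by rewrite /const_fun /= /d /a /b; ring.
have [gYY _] : a = 0 /\ b = 0 by exact: indep.
have Y0 : at_point p Y = 0 by exact: (metric_at_point0 HKen).
have [_ /eqP] : (0 : R) = 0 /\ (1 : R) = 0 by apply: indep; rewrite Y0 scale0r scaler0 addr0.
by rewrite oner_eq0.
Qed.

End KenmotsuThreeManifold.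

Theorem theorem3p3 (R : realType) (M : manifold R 3)
    (phi : vfield M -> vfield M) (xi : vfield M)
    (eta : vfield M -> smooth_fun M)
    (g : vfield M -> vfield M -> smooth_fun M)
    (nabla : vfield M -> vfield M -> vfield M)
    (Hkenmotsu : kenmotsu phi xi eta g nabla)
    (Hsoliton : exists (V : vfield M) (lambda : R),
        star_ricci_soliton phi g nabla V lambda) :
  constant_sectional_curvature g nabla (-1).
Proof.
have HK := kenmotsu_manifold_algebra Hkenmotsu.
have H3 := kenmotsu_three_dimensional Hkenmotsu.
have [mu curvE] := curvature_form HK H3.
have [V [l sol]] := Hsoliton.
have mu0 : mu = 0.
  apply: (star_soliton_curvature HK H3 curvE (V := V) (l := const_fun M l)).
    by move=> X; exact: vfield_const.
  move=> X Y; apply: smooth_funE => p; have := sol X Y p.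
  rewrite (star_ricci_eq Hkenmotsu X Y p curvE) /lie_metric !(sfE, smooth_fun_mulrn).
  rewrite -[const_fun M l p]/l => <-; rewrite /act; ring.
apply: (curvature_flat_sectional Hkenmotsu) => X Y Z.
by rewrite [LHS]curvE mu0 mul0r scale0r addr0.
Qed.
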